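(* Let $\delta > 0$ be a rational number, $n_0 \in \mathbb{N}$, and $M$ be a polynomial-time nondeterministic machine. Then $\mathsf{IS}^1_2 \nvdash \mathsf{LB}^{\mathsf{exp}}(M,2^{n^{\delta}},n_0)$.
   Context: $\mathsf{IS}^1_2$ is Buss's intuitionistic theory of bounded arithmetic: its language is $0, S, +, \times, \#, \lfloor x/2\rfloor, |x|, \leq$ (with $|x|$ the binary length and $x\# y=2^{|x|\cdot|y|}$), it is based on intuitionistic predicate logic, and its non-logical axioms are the basic axioms of $\mathsf{S}^1_2$ together with the polynomial induction scheme $\varphi(0)\wedge\forall x(\varphi(\lfloor x/2\rfloor)\to\varphi(x))\to\forall y\,\varphi(y)$ for $\Sigma^{b+}_1$-formulas $\varphi$ (bounded formulas of class $\Sigma^b_1$ containing no implication or negation). Every polynomial-time function is $\Sigma^{b+}_1$-definable in $\mathsf{IS}^1_2$, which is used to express polynomial-time predicates. For a nondeterministic polynomial-time machine $M$ (with $M(x,y)$ denoting its output on input $x$ and witness $y$), a size bound $s$ and $n_0\in\mathbb{N}$, $\mathsf{LB}^{\mathsf{exp}}(M,s,n_0)$ is the sentence $$\forall N\,\forall n\,\forall D\,\exists x\,\big(n=||N||\wedge n\ge n_0\wedge |x|=n\wedge \mathsf{Circuit}_s(D,n)\to \mathsf{Error}_M(D,n,x)\big),$$ where $\mathsf{Circuit}_s(D,n)$ is a $\Sigma^{b+}_1$-formula expressing that $D$ encodes a co-nondeterministic circuit on $n$ inputs of size at most $s(n)$, and $\mathsf{Error}_M(D,n,x)$ is a formula expressing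 (in the standard model) $(\exists y,z\in\{0,1\}^{s(n)}\,M(x,y)=1\wedge D(x,z)=0)\vee(\forall y,z\in\{0,1\}^{s(n)}\,M(x,y)=0\wedge D(x,z)=1)$, i.e., $D$ and $M$ disagree on the $n$-bit string $x$. (A co-nondeterministic circuit $D(x,z)$ accepts $x$ iff $D(x,z)=1$ for all $z$.) The sentence thus states that for every $n\ge n_0$, no co-nondeterministic circuit of size $s(n)$ decides $L(M)$ on inputs of length $n$. The specific formulas chosen to express these relations are immaterial as long as they have the intended meaning in the standard model $\mathbb{N}$.
   Formalization: In LB^exp the condition |x| = n is moved from the antecedent to the succedent (as a requirement on the witness x); as displayed, any x with |x| ≠ n (e.g. x = 0 for n ≥ 1) makes the sentence trivially provable in IS^1_2. *)

(* Defs.v *)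
From HB Require Import structures.
From mathcomp Require Import all_boot all_order all_algebra.
From mathcomp Require Import reals exp Rstruct.

Set Implicit Arguments.
Unset Strict Implicit.
Unset Printing Implicit Defensive.

Import GRing.Theory Num.Theory.

(* De Bruijn indices *)
Inductive term : Type :=
| Var of nat
| Zero
| Succ of term
| Add of term & term
| Mul of term & term
| Smash of term & term
| Half of term
| Len of term.

Inductive formula : Type :=
| Eq of term & term
| Le of term & term
| Bot
| And of formula & formula
| Or of formula & formula
| Imp of formula & formula
| All of formula
| Ex of formula.

Definition Neg (A : formula) : formula := Imp A Bot.
Definition Iff (A B : formula) : formula := And (Imp A B) (Imp B A).
Definition Neq (t u : term) : formula := Neg (Eq t u).

Fixpoint tsubst (s : nat -> term) (t : term) : term :=
  match t with
  | Var i => s i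
  | Zero => Zero
  | Succ t => Succ (tsubst s t)
  | Add t u => Add (tsubst s t) (tsubst s u)
  | Mul t u => Mul (tsubst s t) (tsubst s u)
  | Smash t u => Smash (tsubst s t) (tsubst s u)
  | Half t => Half (tsubst s t)
  | Len t => Len (tsubst s t)
  end.

Definition tshift : term -> term := tsubst (fun i => Var i.+1).

Definition up (s : nat -> term) (i : nat) : term :=
  if i is j.+1 then tshift (s j) else Var 0.

Fixpoint fsubst (s : nat -> term) (A : formula) : formula :=
  match A with
  | Eq t u => Eq (tsubst s t) (tsubst s u)
  | Le t u => Le (tsubst s t) (tsubst s u)
  | Bot => Bot
  | And A B => And (fsubst s A) (fsubst s B)
  | Or A B => Or (fsubst s A) (fsubst s B)
  | Imp A B => Imp (fsubst s A) (fsubst s B)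
  | All A => All (fsubst (up s) A)
  | Ex A => Ex (fsubst (up s) A)
  end.

Definition fshift : formula -> formula := fsubst (fun i => Var i.+1).

(* Eliminates variable 0 and decrements the other variables. *)
Definition subst0 (t : term) : formula -> formula :=
  fsubst (fun i => if i is j.+1 then Var j else t).

(* Simultaneous instantiation of the variables 0, ..., size ts - 1 of a
   formula that has no other free variable. *)
Definition inst (ts : seq term) : formula -> formula := fsubst (nth Zero ts).

Fixpoint tclosed (k : nat) (t : term) : bool :=
  match t with
  | Var i => i < k
  | Zero => true
  | Succ t | Half t | Len t => tclosed k t
  | Add t u | Mul t u | Smash t u => tclosed k t && tclosed k u
  end.

(* All free variables of the formula are among 0, ..., k - 1. *)
Fixpoint fclosed_at (k : nat) (A : formula) : bool :=
  match A with
  | Eq t u | Le t u => tclosed k t && tclosed k u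
  | Bot => true
  | And A B | Or A B | Imp A B => fclosed_at k A && fclosed_at k B
  | All A | Ex A => fclosed_at k.+1 A
  end.

Definition numeral (n : nat) : term := iter n Succ Zero.

(* The formulas in Ax are used as axioms through their universal closures:
   AllI does not restrict the free variables of axioms. *)
Inductive prv (Ax : formula -> Prop) : seq formula -> formula -> Prop :=
| prv_ax G A of Ax A : prv Ax G A
| prv_hyp G A of List.In A G : prv Ax G A
| prv_botE G A of prv Ax G Bot : prv Ax G A
| prv_andI G A B of prv Ax G A & prv Ax G B : prv Ax G (And A B)
| prv_andEl G A B of prv Ax G (And A B) : prv Ax G A
| prv_andEr G A B of prv Ax G (And A B) : prv Ax G B
| prv_orIl G A B of prv Ax G A : prv Ax G (Or A B)
| prv_orIr G A B of prv Ax G B : prv Ax G (Or A B)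
| prv_orE G A B C of prv Ax G (Or A B) & prv Ax (A :: G) C
    & prv Ax (B :: G) C : prv Ax G C
| prv_impI G A B of prv Ax (A :: G) B : prv Ax G (Imp A B)
| prv_impE G A B of prv Ax G (Imp A B) & prv Ax G A : prv Ax G B
| prv_allI G A of prv Ax (map fshift G) A : prv Ax G (All A)
| prv_allE G A t of prv Ax G (All A) : prv Ax G (subst0 t A)
| prv_exI G A t of prv Ax G (subst0 t A) : prv Ax G (Ex A)
| prv_exE G A C of prv Ax G (Ex A) & prv Ax (A :: map fshift G) (fshift C) :
    prv Ax G C
| prv_eq_refl G t : prv Ax G (Eq t t)
| prv_eq_subst G A t u of prv Ax G (Eq t u) & prv Ax G (subst0 t A) :
    prv Ax G (subst0 u A).

(* Buss's 32 axioms BASIC (Bounded Arithmetic, 1986). *)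
Definition BASIC_axioms : seq formula :=
  let x := Var 0 in let y := Var 1 in let z := Var 2 in
  let u := Var 1 in let v := Var 2 in let w := Var 3 in
  let one := Succ Zero in let two := Succ one in
  let dbl := Mul two in
  [:: Imp (Le y x) (Le y (Succ x));
      Neq x (Succ x);
      Le Zero x;
      Iff (And (Le x y) (Neq x y)) (Le (Succ x) y);
      Imp (Neq x Zero) (Neq (dbl x) Zero);
      Or (Le y x) (Le x y);
      Imp (And (Le x y) (Le y x)) (Eq x y);
      Imp (And (Le x y) (Le y z)) (Le x z);
      Eq (Len Zero) Zero;
      Imp (Neq x Zero) (And (Eq (Len (dbl x)) (Succ (Len x)))
                            (Eq (Len (Succ (dbl x))) (Succ (Len x))));
      Eq (Len one) one;
      Imp (Le x y) (Le (Len x) (Len y));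
      Eq (Len (Smash x y)) (Succ (Mul (Len x) (Len y)));
      Eq (Smash Zero y) one;
      Imp (Neq x Zero)
          (And (Eq (Smash one (dbl x)) (dbl (Smash one x)))
               (Eq (Smash one (Succ (dbl x))) (dbl (Smash one x))));
      Eq (Smash x y) (Smash y x);
      Imp (Eq (Len x) (Len y)) (Eq (Smash x z) (Smash y z));
      Imp (Eq (Len x) (Add (Len u) (Len v)))
          (Eq (Smash x w) (Mul (Smash u w) (Smash v w)));
      Le x (Add x y);
      Imp (And (Le x y) (Neq x y))
          (And (Le (Succ (dbl x)) (dbl y)) (Neq (Succ (dbl x)) (dbl y)));
      Eq (Add x y) (Add y x);
      Eq (Add x Zero) x;
      Eq (Add x (Succ y)) (Succ (Add x y));
      Eq (Add (Add x y) z) (Add x (Add y z));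
      Iff (Le (Add x y) (Add x z)) (Le y z);
      Eq (Mul x Zero) Zero;
      Eq (Mul x (Succ y)) (Add (Mul x y) x);
      Eq (Mul x y) (Mul y x);
      Eq (Mul x (Add y z)) (Add (Mul x y) (Mul x z));
      Imp (Le one x) (Iff (Le (Mul x y) (Mul x z)) (Le y z));
      Imp (Neq x Zero) (Eq (Len x) (Succ (Len (Half x))));
      Iff (Eq x (Half y)) (Or (Eq (dbl x) y) (Eq (Succ (dbl x)) y))].

(* The class Sigma^{b+}_1: no implication or negation, except for the
   implication hidden in the bounded universal quantifier. *)
Inductive Sigma1bp : formula -> Prop :=
| S1_eq t u : Sigma1bp (Eq t u)
| S1_le t u : Sigma1bp (Le t u)
| S1_and A B of Sigma1bp A & Sigma1bp B : Sigma1bp (And A B)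
| S1_or A B of Sigma1bp A & Sigma1bp B : Sigma1bp (Or A B)
| S1_bex t A of Sigma1bp A : Sigma1bp (Ex (And (Le (Var 0) (tshift t)) A))
| S1_sball t A of Sigma1bp A :
    Sigma1bp (All (Imp (Le (Var 0) (Len (tshift t))) A)).

(* The induction variable is variable 0; the others are parameters. *)
Definition PIND (A : formula) : formula :=
  let A_half := fsubst (fun i => if i is 0 then Half (Var 0) else Var i) A in
  Imp (And (subst0 Zero A) (All (Imp A_half A))) (All A).

Inductive IS12 : formula -> Prop :=
| IS12_basic A of List.In A BASIC_axioms : IS12 A
| IS12_pind A of Sigma1bp A : IS12 (PIND A).

(* |x| = ceil (log_2 (x + 1)) *)
Definition bitlen (x : nat) : nat := up_log 2 x.+1.

Fixpoint teval (e : nat -> nat) (t : term) : nat :=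
  match t with
  | Var i => e i
  | Zero => 0
  | Succ t => (teval e t).+1
  | Add t u => teval e t + teval e u
  | Mul t u => teval e t * teval e u
  | Smash t u => 2 ^ (bitlen (teval e t) * bitlen (teval e u))
  | Half t => (teval e t)./2
  | Len t => bitlen (teval e t)
  end.

Definition scons (a : nat) (e : nat -> nat) (i : nat) : nat :=
  if i is j.+1 then e j else a.

Fixpoint sat (e : nat -> nat) (A : formula) : Prop :=
  match A with
  | Eq t u => teval e t = teval e u
  | Le t u => teval e t <= teval e u
  | Bot => False
  | And A B => sat e A /\ sat e B
  | Or A B => sat e A \/ sat e B
  | Imp A B => sat e A -> sat e B
  | All A => forall a, sat (scons a e) A
  | Ex A => exists a, sat (scons a e) A
  end.

(* The binary expansion of x, most significant bit first; this is the string
   of length |x| that the number x stands for. *)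
Definition bits (x : nat) : seq bool :=
  rev [seq odd (x %/ 2 ^ i) | i <- iota 0 (bitlen x)].

Inductive move : Type := MoveLeft | MoveRight.

(* The machine has one tape, infinite to the right, and makes a binary
   nondeterministic choice at each step: [step M b] is the transition function
   used when the choice is b. *)
Record ntm : Type := NTM {
  state : finType;
  symbol : finType;
  blank : symbol;
  insym : bool -> symbol;
  start : state;
  acc : state;
  rej : state;
  step : bool -> state -> symbol -> state * symbol * move;
  insym_inj : injective insym;
  insym_blank : forall b, insym b != blank;
  acc_rej : acc != rej
}.

Record config (M : ntm) : Type := Config {
  cstate : state M;
  chead : nat;
  ctape : nat -> symbol M
}.

Definition init_config (M : ntm) (x : seq bool) : config M :=
  Config (start M) 0
    (fun i => if i < size x then insym M (nth false x i) else blank M).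

Definition halted (M : ntm) (c : config M) : bool :=
  (cstate c == acc M) || (cstate c == rej M).

(* A left move on cell 0 leaves the head there. *)
Definition next_config (M : ntm) (b : bool) (c : config M) : config M :=
  if halted c then c else
  let: (q, a, m) := step b (cstate c) (ctape c (chead c)) in
  Config q (if m is MoveLeft then (chead c).-1 else (chead c).+1)
    (fun i => if i == chead c then a else ctape c i).

(* The t-th step uses bit t of the witness y. A witness longer than the run is
   read only in part; beyond its end a witness reads as 0. *)
Fixpoint run (M : ntm) (x y : seq bool) (t : nat) : config M :=
  if t is t'.+1 then next_config (nth false y t') (run M x y t')
  else init_config M x.

(* M(x, y) = b *)
Definition output (M : ntm) (x y : seq bool) (b : bool) : Prop :=
  exists t, cstate (run M x y t) = if b then acc M else rej M.

Definition polytime (M : ntm) : Prop :=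
  exists k : nat, forall x y : seq bool, halted (run M x y (size x ^ k + k)).

(* A circuit D(x, z) is a straight-line program: the arguments of a gate are
   positions of earlier gates, and the last gate is the output. Input nodes
   count as gates. *)
Inductive gate : Type :=
| GConst of bool
| GX of nat
| GZ of nat
| GNot of nat
| GAnd of nat & nat
| GOr of nat & nat.

Definition circuit : Type := seq gate.

Definition gate_val (x z vs : seq bool) (g : gate) : bool :=
  match g with
  | GConst b => b
  | GX i => nth false x i
  | GZ j => nth false z j
  | GNot a => ~~ nth false vs a
  | GAnd a b => nth false vs a && nth false vs b
  | GOr a b => nth false vs a || nth false vs b
  end.

Definition circuit_vals (c : circuit) (x z : seq bool) : seq bool :=
  foldl (fun vs g => rcons vs (gate_val x z vs g)) [::] c.

Definition circuit_val (c : circuit) (x z : seq bool) : bool :=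
  last false (circuit_vals c x z).

Definition gate_wf (n k p : nat) (g : gate) : bool :=
  match g with
  | GConst _ => true
  | GX i => i < n
  | GZ j => j < k
  | GNot a => a < p
  | GAnd a b | GOr a b => (a < p) && (b < p)
  end.

(* c has input variables x_0 ... x_(n-1) and z_0 ... z_(k-1). *)
Definition circuit_wf (n k : nat) (c : circuit) : Prop :=
  0 < size c /\
  forall p, p < size c -> gate_wf n k p (nth (GConst false) c p).

Definition gate_code (g : gate) : seq nat :=
  match g with
  | GConst b => [:: 0; nat_of_bool b; 0]
  | GX i => [:: 1; i; 0]
  | GZ j => [:: 2; j; 0]
  | GNot a => [:: 3; a; 0]
  | GAnd a b => [:: 4; a; b]
  | GOr a b => [:: 5; a; b]
  end.

(* CodeSeq.code writes the entries of the sequence in unary in the binary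
   expansion of the code, so the length of the code is polynomial in the size
   of the circuit and in its numbers of inputs. *)
Definition encodes (D : nat) (c : circuit) : Prop :=
  D = CodeSeq.code (flatten (map gate_code c)).

(* D encodes a co-nondeterministic circuit on n inputs of size at most s n. *)
Definition encodes_circuit (s : nat -> nat) (D n : nat) (c : circuit) : Prop :=
  [/\ encodes D c, circuit_wf n (s n) c & size c <= s n].

(* D and M disagree on x; y and z range over the strings of length k. *)
Definition disagree (M : ntm) (k : nat) (c : circuit) (x : seq bool) : Prop :=
  (exists y z : k.-tuple bool, output M x y true /\ circuit_val c x z = false)
  \/ (forall y z : k.-tuple bool,
        output M x y false /\ circuit_val c x z = true).

(* The size bound 2^(n^delta), rounded down. *)
Definition exp_size (delta : rat) (n : nat) : nat :=
  let R := Rdefinitions.R in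
  Num.truncn (powR (2%:R : R) (powR (n%:R : R) (ratr delta)))%R.

(* Variables: 0 for D and 1 for n. *)
Definition is_Circuit_formula (s : nat -> nat) (C : formula) : Prop :=
  [/\ Sigma1bp C, fclosed_at 2 C &
      forall e, sat e C <-> exists c, encodes_circuit s (e 0) (e 1) c].

(* Variables: 0 for D, 1 for n and 2 for x. The formula may mean anything when
   D is not a circuit of the required form or x is not an n-bit string. *)
Definition is_Error_formula (M : ntm) (s : nat -> nat) (E : formula) : Prop :=
  fclosed_at 3 E /\
  forall e c, encodes_circuit s (e 0) (e 1) c -> bitlen (e 2) = e 1 ->
    (sat e E <-> disagree M (s (e 1)) c (bits (e 2))).

(* The condition |x| = n is a requirement on the witness x, so it stands in
   the succedent: in the antecedent, any x with |x| <> n would be a witness. *)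
Definition LB_exp (C E : formula) (n0 : nat) : formula :=
  let N := Var 3 in let n := Var 2 in let D := Var 1 in let x := Var 0 in
  All (All (All (Ex
    (Imp (And (Eq n (Len (Len N))) (And (Le (numeral n0) n) (inst [:: D; n] C)))
         (And (Eq (Len x) n) (inst [:: D; n; x] E)))))).

(* Main.v *)
Require Import Defs.
From mathcomp Require Import all_boot all_order all_algebra.
From mathcomp Require Import zify.
From mathcomp Require Import boolp reals exp Rstruct.

(* Suppose the lower bound is provable.  Forcing over families of functions
   computed by Boolean circuits of size 2^O(n) is sound for IS12: a witness of a
   Sigma^{b+}_1 formula becomes a bit stream computed by such circuits, and
   polynomial induction becomes an iteration of circuits.  Hence an error
   x = f(N, n, D) of D is computed, for n = ||N||, by circuits of size 2^O(n).
   Given a string u of length m = n^q, let D_u be the circuit D_u(x, z) = not M(u, z).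
   It has size polynomial in n, ignores x, and rejects exactly when u is in L(M),
   so its error x of length n satisfies: x in L(M) iff u in L(M).  Looking up x
   in a table of size 2^n decides L(M) on strings of length m with circuits of
   size 2^O(n), which is below 2^(m^delta) once q * delta >= 2.  This contradicts
   the lower bound at length m, which is true because IS12 is sound. *)

Set Implicit Arguments.
Unset Strict Implicit.
Unset Printing Implicit Defensive.

Import Order.TTheory GRing.Theory Num.Theory.

(** * Circuit complexity relative to available functions *)

(** The choice n = ||N|| gives N about 2^n bits, so terms take values with 2^O(n) bits and
    polynomial time in |N| becomes size 2^O(n). Nonuniformity is harmless because the contradiction
    is with a circuit lower bound; tables and codes can be hard-wired.

    [Error] is an arbitrary formula with a prescribed meaning, so its forcing yields nothing by
    itself. What is wanted is the truth of the implication at a feasible x; this is why truth is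
    built into the clause for implication.

    The obstacle is induction: a forced implication between formulas is not a circuit. Formulas of
    the class Sigma^{b+}_1 are forced exactly when they have a feasible realizer, a stream related
    pointwise to the environment. With a realizer of the premise as an additional input, the
    induction step becomes a single circuit that can be iterated.

    The lower bound serves twice: through its proof at length n, as a mere truth at length m. By the
    choice of q, s(l^q) >= 2^(l^2). With l = n this exceeds 2^O(n) at m = n^q; taking n itself of
    the form l^q, the same estimate puts the polynomial size of D_u below s(n). *)

Definition stream := nat -> bool.
(** Circuits of all sizes read the same infinite input, so composing them never has to adjust an
    arity. *)
Definition bfun := stream -> bool.

Definition gate_over (L : seq bfun) (f : bfun) : Prop :=
  List.In f L \/ (exists b, f = fun=> b) \/ (exists i, f = fun s => s i) \/
  (exists2 g, List.In g L & f = fun s => ~~ g s) \/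
  (exists g h, [/\ List.In g L, List.In h L & f = fun s => g s && h s]) \/
  (exists g h, [/\ List.In g L, List.In h L & f = fun s => g s || h s]).

(* Straight-line programs over [L], the last instruction being the head. *)
Fixpoint slp (L L' : seq bfun) : Prop :=
  if L' is f :: L'' then gate_over (L'' ++ L) f /\ slp L L'' else True.

(** The functions in [L] come for free; with [L] empty this is nonuniform circuit size. The relative
    form lets a later stage reuse the wires of an earlier one. *)
Definition rcx (L : seq bfun) (f : bfun) (p : nat) : Prop :=
  exists L', [/\ slp L L', size L' <= p & List.In f (L' ++ L)].

Lemma gate_over_sub L L' f :
  (forall g, List.In g L -> List.In g L') -> gate_over L f -> gate_over L' f.
Proof.
move=> sub; case=> [H|[H|[H|[[g Hg ->]|[[g [h [Hg Hh ->]]]|[g [h [Hg Hh ->]]]]]]]].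
- by left; apply: sub.
- by right; left.
- by right; right; left.
- by right; right; right; left; exists g; first exact: sub.
- by do 4 right; left; exists g, h; split; [exact: sub | exact: sub |].
- by do 5 right; exists g, h; split; [exact: sub | exact: sub |].
Qed.

Lemma slp_sub L L1 L' :
  (forall g, List.In g L -> List.In g L1) -> slp L L' -> slp L1 L'.
Proof.
move=> sub; elim: L' => [//|f L' IH] /= [H1 H2]; split; last exact: IH.
apply: gate_over_sub H1 => g /List.in_app_iff [Hg|Hg]; apply/List.in_app_iff; first by left.
by right; apply: sub.
Qed.

Lemma slp_cat L L1 L2 : slp L L1 -> slp (L1 ++ L) L2 -> slp L (L2 ++ L1).
Proof.
move=> H1; elim: L2 => [//|f L2 IH] /= [H2 H3]; split; last exact: IH.
by rewrite -catA.
Qed.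

Lemma rcx_mono L f p q : rcx L f p -> p <= q -> rcx L f q.
Proof. by move=> [L' [H1 H2 H3]] pq; exists L'; split=> //; apply: leq_trans pq. Qed.

Lemma rcx_sub L L1 f p :
  (forall g, List.In g L -> List.In g L1) -> rcx L f p -> rcx L1 f p.
Proof.
move=> sub [L' [H1 H2 H3]]; exists L'; split=> //; first exact: slp_sub H1.
by move/List.in_app_iff: H3 => [Hg|Hg]; apply/List.in_app_iff; [left|right; apply: sub].
Qed.

Lemma rcx_nil L f p : rcx [::] f p -> rcx L f p.
Proof. exact: rcx_sub. Qed.

Lemma rcx_in L f : List.In f L -> rcx L f 0.
Proof. by move=> H; exists [::]; split. Qed.

Lemma rcx_gate0 L f : gate_over L f -> rcx L f 1.
Proof. by move=> H; exists [:: f]; split=> //=; left. Qed.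

Lemma rcx_const L b : rcx L (fun=> b) 1.
Proof. by apply: rcx_gate0; right; left; exists b. Qed.

Lemma rcx_var L i : rcx L (fun s => s i) 1.
Proof. by apply: rcx_gate0; right; right; left; exists i. Qed.

Lemma rcx_comb L f g p q h :
  rcx L f p -> rcx L g q ->
  (forall L', List.In f L' -> List.In g L' -> gate_over L' h) ->
  rcx L h (p + q + 1).
Proof.
move=> [Lf [f1 f2 f3]] [Lg [g1 g2 g3]] H.
exists ((h :: Lg) ++ Lf); split.
- apply: slp_cat => //=; split.
    apply: H; last first.
      by apply/List.in_app_iff; move/List.in_app_iff: g3 => [?|?]; [left|right; apply/List.in_app_iff; right].
    by apply/List.in_app_iff; right.
  by apply: slp_sub g1 => k Hk; apply/List.in_app_iff; right.
- by rewrite size_cat /=; lia.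
- by left.
Qed.

Lemma rcx_not L f p : rcx L f p -> rcx L (fun s => ~~ f s) (p + 1).
Proof.
move=> [L' [H1 H2 H3]]; exists ((fun s => ~~ f s) :: L'); split => /=.
- by split=> //; do 3 right; left; exists f.
- by lia.
- by left.
Qed.

Lemma rcx_and L f g p q :
  rcx L f p -> rcx L g q -> rcx L (fun s => f s && g s) (p + q + 1).
Proof. by move=> Hf Hg; apply: (rcx_comb Hf Hg) => L' ? ?; do 4 right; left; exists f, g. Qed.

Lemma rcx_or L f g p q :
  rcx L f p -> rcx L g q -> rcx L (fun s => f s || g s) (p + q + 1).
Proof. by move=> Hf Hg; apply: (rcx_comb Hf Hg) => L' ? ?; do 5 right; exists f, g. Qed.

Lemma rcx_eqf L f g p : f =1 g -> rcx L f p -> rcx L g p.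
Proof. by move=> /funext ->. Qed.

Lemma rcx_if L b f g p q r :
  rcx L b p -> rcx L f q -> rcx L g r ->
  rcx L (fun s => if b s then f s else g s) (2 * p + q + r + 4).
Proof.
move=> Hb Hf Hg.
apply: rcx_mono (rcx_eqf _ (rcx_or (rcx_and Hb Hf) (rcx_and (rcx_not Hb) Hg))) _; last lia.
by move=> s /=; case: (b s); rewrite ?orbF.
Qed.

Lemma rcx_xor L f g p q :
  rcx L f p -> rcx L g q -> rcx L (fun s => f s (+) g s) (p + 2 * q + p + 5).
Proof.
move=> Hf Hg.
apply: rcx_mono (rcx_eqf _ (rcx_if Hf (rcx_not Hg) Hg)) _; last lia.
by move=> s /=; case: (f s).
Qed.

Lemma rcx_bigor L (J : Type) (r : seq J) (P : pred J) (f : J -> bfun) p :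
  (forall j, rcx L (f j) p) ->
  rcx L (fun s => \big[orb/false]_(j <- r | P j) f j s) (size r * (p + 1) + 1).
Proof.
move=> H; elim: r => [|j r IH].
  by apply: (rcx_eqf (f := fun=> false)) => [s|]; [rewrite big_nil | exact: rcx_const].
case Pj: (P j).
  apply: rcx_mono (rcx_eqf _ (rcx_or (H j) IH)) _ => [s|/=]; last lia.
  by rewrite /= big_cons Pj.
by apply: rcx_mono (rcx_eqf _ IH) _ => [s|/=]; [rewrite /= big_cons Pj | lia].
Qed.

Lemma rcx_exists L (J : finType) (P : pred J) (f : J -> bfun) p :
  (forall j, rcx L (f j) p) ->
  rcx L (fun s => [exists j, P j && f j s]) (#|J| * (p + 1) + 1).
Proof.
move=> H; have := rcx_bigor (enum J) P H; rewrite -cardE.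
by apply: rcx_eqf => s; rewrite big_enum_cond /= big_orE.
Qed.

(** Each of the at most [p] instructions for [f] is copied or, if it reads an input bit, replaced by
    the program for that bit. *)
Lemma rcx_subst L f p G q :
  rcx [::] f p -> (forall i, rcx L (fun s => G s i) q) ->
  rcx L (fun s => f (G s)) (p * (q + 1)).
Proof.
move=> [L' [H1 H2 H3]] HG; rewrite cats0 in H3.
suff [L2 [K1 K2 K3]] : exists L2, [/\ slp L L2, size L2 <= size L' * (q + 1) &
    forall g, List.In g L' -> List.In (fun s => g (G s)) (L2 ++ L)].
  by exists L2; split; [| apply: (leq_trans K2); rewrite leq_mul2r H2 orbT | exact: K3].
elim: L' {H2 H3} H1 => [_|g L' IH /= [Hg /IH [L2 [K1 K2 K3]]]]; first by exists [::].
suff [L3 [M1 M2 M3]] : rcx (L2 ++ L) (fun s => g (G s)) (q + 1).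
  exists (L3 ++ L2); split; first exact: slp_cat.
    by rewrite size_cat; lia.
  move=> h [<-|/K3 hh]; rewrite -catA //.
  by apply/List.in_app_iff; right.
rewrite cats0 in Hg.
case: Hg => [/K3 Hg|[[b ->]|[[i ->]|[[g' /K3 Hg ->]|[[g' [h [/K3 Hg /K3 Hh ->]]]|[g' [h [/K3 Hg /K3 Hh ->]]]]]]]].
- by apply: rcx_mono (rcx_in Hg) _.
- by apply: rcx_mono (rcx_const _ _) _; lia.
- apply: rcx_mono (rcx_sub _ (HG i)) _; last lia.
  by move=> k Hk; apply/List.in_app_iff; right.
- by apply: rcx_mono (rcx_not (rcx_in Hg)) _; lia.
- by apply: rcx_mono (rcx_and (rcx_in Hg) (rcx_in Hh)) _; lia.
- by apply: rcx_mono (rcx_or (rcx_in Hg) (rcx_in Hh)) _; lia.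
Qed.

Lemma rcx_joint L (I : finType) (v : I -> bfun) p :
  (forall i, rcx L (v i) p) ->
  exists L', [/\ slp L L', size L' <= #|I| * p & forall i, List.In (v i) (L' ++ L)].
Proof.
move=> H.
suff [L' [H1 H2 H3]] : exists L', [/\ slp L L', size L' <= size (enum I) * p &
    forall i, i \in enum I -> List.In (v i) (L' ++ L)].
  by exists L'; split=> //; [rewrite cardE | move=> i; apply: H3; rewrite mem_enum].
elim: (enum I) => [|i r [L' [H1 H2 H3]]]; first by exists [::].
have [L2 [K1 K2 K3]] := H i.
exists (L2 ++ L'); split.
- apply: slp_cat H1 _; apply: slp_sub K1 => g Hg.
  by apply/List.in_app_iff; right.
- by rewrite size_cat /=; lia.
move=> j; rewrite -catA inE => /orP [/eqP ->|/H3 Hj]; apply/List.in_app_iff.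
  by move/List.in_app_iff: K3 => [?|?]; [left | right; apply/List.in_app_iff; right].
by right.
Qed.

(** Iterated substitution would multiply sizes. Carrying all the wires of the state forward makes
    [t] rounds cost [t] times one round; every loop below, from ripple-carry addition to polynomial
    induction and machine runs, has this form. *)
Lemma rcx_serial L (I : finType) (v : nat -> I -> bfun) p q :
  (forall i, rcx L (v 0 i) q) ->
  (forall t L', (forall f, List.In f L -> List.In f L') ->
     (forall i, List.In (v t i) L') -> forall i, rcx L' (v t.+1 i) p) ->
  forall t i, rcx L (v t i) (#|I| * q + t * (#|I| * p)).
Proof.
move=> H0 HS t.
suff [L' [H1 H2 H3]] : exists L', [/\ slp L L', size L' <= #|I| * q + t * (#|I| * p) &
    forall i, List.In (v t i) (L' ++ L)].
  by move=> i; exists L'; split.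
elim: t => [|t [L' [H1 H2 H3]]].
  by have [L' [H1 H2 H3]] := rcx_joint H0; exists L'; split=> //; lia.
have sub f : List.In f L -> List.In f (L' ++ L).
  by move=> ?; apply/List.in_app_iff; right.
have [L2 [K1 K2 K3]] := rcx_joint (HS t _ sub H3).
exists (L2 ++ L'); split; first exact: slp_cat.
  by rewrite size_cat; lia.
by move=> i; rewrite -catA.
Qed.

(** * Arithmetic on binary representations *)

Definition testbit (x i : nat) : bool := odd (x %/ 2 ^ i).

Definition ofbits (T : nat) (b : nat -> bool) : nat := \sum_(i < T) b i * 2 ^ i.

Lemma modn_exp2S x i : x %% 2 ^ i.+1 = testbit x i * 2 ^ i + x %% 2 ^ i.
Proof.
rewrite /testbit {1}(divn_eq x (2 ^ i)) {1}(divn_eq (x %/ 2 ^ i) 2) modn2.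
have h : 0 < 2 ^ i by rewrite expn_gt0.
have hr := ltn_pmod x h.
set b := odd _; set r := x %% _ in hr *; set q := _ %/ 2.
have -> : (q * 2 + b) * 2 ^ i + r = q * 2 ^ i.+1 + (b * 2 ^ i + r).
  by rewrite mulnDl -mulnA -expnS addnA.
rewrite modnMDl modn_small // expnS.
by case: b => /=; lia.
Qed.

Lemma testbit_small x i T : x < 2 ^ T -> T <= i -> testbit x i = false.
Proof.
by move=> h hi; rewrite /testbit divn_small // (leq_trans h) // leq_exp2l.
Qed.

Lemma ofbits_testbit T x : ofbits T (testbit x) = x %% 2 ^ T.
Proof.
elim: T => [|T IH]; first by rewrite /ofbits big_ord0 modn1.
by rewrite modn_exp2S -IH /ofbits big_ord_recr addnC.
Qed.

Lemma ofbits_testbitK T x : x < 2 ^ T -> ofbits T (testbit x) = x.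
Proof. by move=> h; rewrite ofbits_testbit modn_small. Qed.

Lemma ofbits_lt T b : ofbits T b < 2 ^ T.
Proof.
elim: T => [|T IH]; first by rewrite /ofbits big_ord0.
rewrite /ofbits big_ord_recr /= -/(ofbits T b) expnS.
by case: (b T) => /=; lia.
Qed.

Lemma testbitMD q T r i : r < 2 ^ T ->
  testbit (q * 2 ^ T + r) i = if i < T then testbit r i else testbit q (i - T).
Proof.
move=> h; rewrite /testbit; case: ltnP => iT.
  have {1}-> : T = (T - i.+1).+1 + i by lia.
  by rewrite expnD mulnA divnMDl ?expn_gt0 // oddD expnS mulnCA oddM.
rewrite -{1}(subnK iT) (addnC (i - T)) expnD divnMA divnMDl ?expn_gt0 //.
by rewrite (divn_small h) addn0.
Qed.

Lemma testbit_ofbits T b i : testbit (ofbits T b) i = (i < T) && b i.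
Proof.
elim: T i => [|T IH] i; first by rewrite /ofbits big_ord0 /testbit div0n.
rewrite /ofbits big_ord_recr /= -/(ofbits T b) addnC testbitMD ?ofbits_lt // IH ltnS.
case: ltngtP => //= [iT|->].
  by apply: (@testbit_small _ _ 1); [case: (b T) | lia].
by rewrite subnn /testbit divn1; case: (b T).
Qed.

Lemma eq_testbit T x y : x < 2 ^ T -> y < 2 ^ T ->
  (forall i, i < T -> testbit x i = testbit y i) -> x = y.
Proof.
move=> hx hy h; rewrite -(ofbits_testbitK hx) -(ofbits_testbitK hy).
by apply: eq_bigr => i _; rewrite h.
Qed.

(** The inequality is the carry into position [i]. By [carryS] it propagates where the two bits
    differ and otherwise equals their common value. *)
Lemma testbitD x y i : testbit (x + y) i =
  testbit x i (+) testbit y i (+) (2 ^ i <= x %% 2 ^ i + y %% 2 ^ i).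
Proof. by rewrite /testbit divnD ?expn_gt0 // !oddD oddb. Qed.

Lemma carryS x y i :
  (2 ^ i.+1 <= x %% 2 ^ i.+1 + y %% 2 ^ i.+1) =
  if testbit x i (+) testbit y i then 2 ^ i <= x %% 2 ^ i + y %% 2 ^ i
  else testbit x i.
Proof.
rewrite !modn_exp2S expnS.
have h : 0 < 2 ^ i by rewrite expn_gt0.
have hx := ltn_pmod x h; have hy := ltn_pmod y h.
by case: (testbit x i); case: (testbit y i) => /=; apply/idP/idP; lia.
Qed.

Lemma leq_modS x y i :
  (x %% 2 ^ i.+1 <= y %% 2 ^ i.+1) =
  if testbit x i (+) testbit y i then testbit y i
  else x %% 2 ^ i <= y %% 2 ^ i.
Proof.
rewrite !modn_exp2S.
have h : 0 < 2 ^ i by rewrite expn_gt0.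
have hx := ltn_pmod x h; have hy := ltn_pmod y h.
by case: (testbit x i); case: (testbit y i) => /=; apply/idP/idP; lia.
Qed.

Lemma testbit_half x i : testbit x./2 i = testbit x i.+1.
Proof. by rewrite /testbit expnS divnMA divn2. Qed.

Lemma bitlen_leq x i : (bitlen x <= i) = (x < 2 ^ i).
Proof.
rewrite /bitlen; apply/idP/idP => [h|]; last exact: up_log_min.
by apply: leq_trans (up_logP x.+1 (isT : 1 < 2)) _; rewrite leq_exp2l.
Qed.

Lemma ltn_bitlen x : x < 2 ^ bitlen x.
Proof. by rewrite -bitlen_leq. Qed.

Lemma testbit_exp2 k i : testbit (2 ^ k) i = (i == k).
Proof.
have := @testbitMD 1 k 0 i; rewrite mul1n addn0 => -> ; last by rewrite expn_gt0.
case: ltngtP => [ik|ik|->].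
- by rewrite /testbit div0n.
- by apply: (@testbit_small _ _ 1); lia.
- by rewrite subnn.
Qed.

(** * Circuits for arithmetic, comparison and table look-up *)

Lemma rcx_bits_small L (X : stream -> nat) T p :
  (forall s, X s < 2 ^ T) ->
  (forall i, i < T -> rcx L (fun s => testbit (X s) i) p) ->
  forall i, rcx L (fun s => testbit (X s) i) (p + 1).
Proof.
move=> hX H i; case: (ltnP i T) => iT; first by apply: rcx_mono (H i iT) _; lia.
apply: rcx_mono (rcx_eqf _ (rcx_const L false)) _; last lia.
by move=> s /=; rewrite (testbit_small (hX s) iT).
Qed.

Lemma rcx_addn L (X Y : stream -> nat) p q T :
  (forall i, rcx L (fun s => testbit (X s) i) p) ->
  (forall i, rcx L (fun s => testbit (Y s) i) q) ->
  forall i, i < T ->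
  rcx L (fun s => testbit (X s + Y s) i) ((T + 6) * (10 * p + 10 * q + 50)).
Proof.
move=> hX hY i iT.
have C : rcx L (fun s => 2 ^ i <= X s %% 2 ^ i + Y s %% 2 ^ i)
    (#|{: unit}| * 1 + i * (#|{: unit}| * (5 * p + 5 * q + 20))).
  apply: (@rcx_serial L unit
     (fun t _ s => 2 ^ t <= X s %% 2 ^ t + Y s %% 2 ^ t) _ _ _ _ i tt).
    by move=> _; apply: rcx_eqf (rcx_const _ false) => s; rewrite !modn1.
  move=> t L' sub hL' _.
  have hXY := rcx_xor (rcx_sub sub (hX t)) (rcx_sub sub (hY t)).
  apply: rcx_mono (rcx_eqf _ (rcx_if hXY (rcx_in (hL' tt)) (rcx_sub sub (hX t)))) _.
    by move=> s /=; rewrite carryS.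
  lia.
apply: rcx_mono (rcx_eqf _ (rcx_xor (rcx_xor (hX i) (hY i)) C)) _.
  by move=> s /=; rewrite testbitD.
rewrite card_unit; nia.
Qed.

Lemma rcx_leq L (X Y : stream -> nat) p q T :
  (forall s, X s < 2 ^ T) -> (forall s, Y s < 2 ^ T) ->
  (forall i, rcx L (fun s => testbit (X s) i) p) ->
  (forall i, rcx L (fun s => testbit (Y s) i) q) ->
  rcx L (fun s => X s <= Y s) ((T + 1) * (4 * p + 5 * q + 20)).
Proof.
move=> bX bY hX hY.
have C : rcx L (fun s => X s %% 2 ^ T <= Y s %% 2 ^ T)
    (#|{: unit}| * 1 + T * (#|{: unit}| * (4 * p + 5 * q + 20))).
  apply: (@rcx_serial L unit
     (fun t _ s => X s %% 2 ^ t <= Y s %% 2 ^ t) _ _ _ _ T tt).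
    by move=> _; apply: rcx_eqf (rcx_const _ true) => s; rewrite !modn1.
  move=> t L' sub hL' _.
  have hXY := rcx_xor (rcx_sub sub (hX t)) (rcx_sub sub (hY t)).
  apply: rcx_mono (rcx_eqf _ (rcx_if hXY (rcx_sub sub (hY t)) (rcx_in (hL' tt)))) _.
    by move=> s /=; rewrite leq_modS.
  lia.
apply: rcx_mono (rcx_eqf _ C) _; first by move=> s /=; rewrite !modn_small.
rewrite card_unit; nia.
Qed.

Lemma rcx_eqn L (X Y : stream -> nat) p q T :
  (forall s, X s < 2 ^ T) -> (forall s, Y s < 2 ^ T) ->
  (forall i, rcx L (fun s => testbit (X s) i) p) ->
  (forall i, rcx L (fun s => testbit (Y s) i) q) ->
  rcx L (fun s => X s == Y s) ((T + 1) * (9 * p + 9 * q + 41)).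
Proof.
move=> bX bY hX hY.
apply: rcx_mono (rcx_eqf _ (rcx_and (rcx_leq bX bY hX hY) (rcx_leq bY bX hY hX))) _.
  by move=> s /=; rewrite eqn_leq.
by lia.
Qed.

(** School multiplication: the state after [t] rounds is X * (Y mod 2^t), and the next round adds X
    shifted by [t] if bit [t] of Y is set. *)
Lemma rcx_muln L (X Y : stream -> nat) p q T1 T2 :
  (forall s, X s < 2 ^ T1) -> (forall s, Y s < 2 ^ T2) ->
  (forall i, rcx L (fun s => testbit (X s) i) p) ->
  (forall i, rcx L (fun s => testbit (Y s) i) q) ->
  forall i, i < T1 + T2 ->
  rcx L (fun s => testbit (X s * Y s) i)
    ((T1 + T2) * 1 + T2 * ((T1 + T2) *
      ((T1 + T2 + 6) * (10 * 1 + 10 * (p + q + 1) + 50)))).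
Proof.
move=> bX bY hX hY i iB; set B := T1 + T2 in iB *.
have bA t s : t <= T2 -> X s * (Y s %% 2 ^ t) < 2 ^ B.
  move=> tT; rewrite /B expnD.
  have := bX s; have : Y s %% 2 ^ t < 2 ^ T2; last nia.
  by apply: leq_trans (ltn_pmod _ _) _; rewrite ?expn_gt0 ?leq_exp2l.
(* [rcx_serial] asks for a step at every [t]; [minn] freezes the state after the last round. *)
have C : rcx L (fun s => testbit (X s * (Y s %% 2 ^ minn T2 T2)) i)
   (#|'I_B| * 1 + T2 * (#|'I_B| * ((B + 6) * (10 * 1 + 10 * (p + q + 1) + 50)))).
  apply: (@rcx_serial L 'I_B
     (fun t i s => testbit (X s * (Y s %% 2 ^ minn t T2)) i) _ _ _ _ T2 (Ordinal iB)).
    move=> j; apply: rcx_eqf (rcx_const _ false) => s.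
    by rewrite min0n modn1 muln0 /testbit div0n.
  move=> t L' sub hL' j.
  have [tT|tT] := ltnP t T2; last first.
    apply: rcx_mono (rcx_eqf _ (rcx_in (hL' j))) _ => [s|//].
    by rewrite /minn ltnNge tT /= ltnNge (leq_trans tT).
  have hacc k : rcx L' (fun s => testbit (X s * (Y s %% 2 ^ minn t T2)) k) (0 + 1).
    apply: (@rcx_bits_small _ _ B) => [s|k' kB].
      by apply: bA; exact: geq_minr.
    exact: rcx_in (hL' (Ordinal kB)).
  have hsum k : rcx L' (fun s => testbit (testbit (Y s) t * X s * 2 ^ t) k) (p + q + 1).
    have [kt|kt] := ltnP k t.
      apply: rcx_mono (rcx_eqf _ (rcx_const _ false)) _ => [s|]; last lia.
      have := @testbitMD (testbit (Y s) t * X s) t 0 k.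
      by rewrite addn0 => -> //; rewrite ?expn_gt0 // kt /testbit div0n.
    apply: rcx_mono (rcx_eqf _ (rcx_and (rcx_sub sub (hY t)) (rcx_sub sub (hX (k - t))))) _ => [s|]; last lia.
    have := @testbitMD (testbit (Y s) t * X s) t 0 k.
    rewrite addn0 => -> //; rewrite ?expn_gt0 // ltnNge kt /=.
    by case: (testbit (Y s) t); rewrite ?mul1n ?mul0n //= /testbit div0n.
  apply: rcx_mono (rcx_eqf _ (rcx_addn hacc hsum (ltn_ord j))) _ => [s /=|//].
  congr testbit; rewrite (minn_idPl tT) (minn_idPl (ltnW tT)) modn_exp2S mulnDr addnC.
  by congr addn; rewrite -!mulnA mulnCA.
rewrite card_ord in C; apply: rcx_eqf C => s.
by rewrite minnn modn_small.
Qed.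

Lemma rcx_bitlen_leq L (X : stream -> nat) p T k :
  (forall s, X s < 2 ^ T) ->
  (forall i, rcx L (fun s => testbit (X s) i) p) ->
  rcx L (fun s => bitlen (X s) <= k) (T * (p + 1) + 2).
Proof.
move=> bX hX.
have := rcx_not (rcx_bigor (iota 0 T) (fun i => k <= i) hX).
rewrite size_iota -addnA; apply: rcx_eqf => s.
rewrite bitlen_leq big_has_cond; apply/idP/idP => [h|h].
  have E : X s %% 2 ^ k = X s; last by rewrite -E ltn_pmod // expn_gt0.
  apply: (@eq_testbit (maxn T k)).
  - rewrite (leq_ltn_trans (leq_mod _ _)) // (leq_trans (bX s)) //.
    by rewrite leq_exp2l // leq_maxl.
  - by rewrite (leq_trans (bX s)) // leq_exp2l // leq_maxl.
  move=> i _; rewrite -ofbits_testbit testbit_ofbits; case: ltnP => //= ki.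
  case: (ltnP i T) => iT; last by rewrite (testbit_small (bX s)).
  apply/esym/negbTE; apply: contra h => h.
  by apply/hasP; exists i; rewrite ?mem_iota //= ki.
by apply/hasPn => i _; rewrite negb_and -implybE; apply/implyP => /(testbit_small h) ->.
Qed.

Lemma rcx_bitlen_eq L (X : stream -> nat) p T k :
  (forall s, X s < 2 ^ T) ->
  (forall i, rcx L (fun s => testbit (X s) i) p) ->
  rcx L (fun s => bitlen (X s) == k) (2 * T * (p + 1) + 10).
Proof.
move=> bX hX; case: k => [|k].
  apply: rcx_mono (rcx_eqf _ (rcx_bitlen_leq 0 bX hX)) _ => [s /=|]; last nia.
  by rewrite leqn0.
apply: rcx_mono (rcx_eqf _ (rcx_and (rcx_bitlen_leq k.+1 bX hX) (rcx_not (rcx_bitlen_leq k bX hX)))) _ => [s /=|]; last nia.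
by rewrite -ltnNge [RHS]eqn_leq.
Qed.

(** A multiplexer, affordable whenever the selector has only 2^O(n) values: lengths, indices of
    sharply bounded quantifiers, and the final table. *)
Lemma rcx_lookup L (Z : stream -> nat) (F : nat -> bfun) p q K :
  (forall s, Z s < K) -> (forall k, k < K -> rcx L (fun s => Z s == k) p) ->
  (forall k, rcx L (F k) q) ->
  rcx L (fun s => F (Z s) s) (K * (p + q + 2) + 1).
Proof.
move=> bZ hZ hF.
have := rcx_exists (J := 'I_K) predT (fun j => rcx_and (hZ _ (ltn_ord j)) (hF j)).
rewrite card_ord => H; apply: rcx_mono (rcx_eqf _ H) _ => [s /=|]; last lia.
apply/existsP/idP => [[j /andP [/eqP -> //]]|h].
by exists (Ordinal (bZ s)); rewrite eqxx.
Qed.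

(** * Feasible families and forcing *)

Definition scaled (b : nat -> nat) : Prop :=
  exists c, forall n, b n <= 2 ^ (c * n.+1).

Lemma scaled_le b b' : (forall n, b n <= b' n) -> scaled b' -> scaled b.
Proof. by move=> h [c hc]; exists c => n; apply: leq_trans (h n) (hc n). Qed.

Lemma scaled_const k : scaled (fun=> k).
Proof.
exists k => n; apply: leq_trans (ltnW (ltn_expl k (isT : 1 < 2))) _.
by rewrite leq_exp2l // leq_pmulr.
Qed.

Lemma scaledM a b : scaled a -> scaled b -> scaled (fun n => a n * b n).
Proof.
move=> [c hc] [d hd]; exists (c + d) => n.
by rewrite mulnDl expnD leq_mul.
Qed.

Lemma scaledD a b : scaled a -> scaled b -> scaled (fun n => a n + b n).
Proof.
move=> [c hc] [d hd]; exists (c + d).+1 => n.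
rewrite mulSn mulnDl !expnD.
have := hc n; have := hd n.
have : 0 < 2 ^ (c * n.+1) by rewrite expn_gt0.
have : 0 < 2 ^ (d * n.+1) by rewrite expn_gt0.
have : 2 <= 2 ^ n.+1 by rewrite expnS leq_pmulr ?expn_gt0.
set x := 2 ^ (c * _); set y := 2 ^ (d * _); set z := 2 ^ n.+1 => z2 y0 x0 ha hb.
have : x * y >= x by rewrite leq_pmulr.
have : x * y >= y by rewrite leq_pmull.
nia.
Qed.

Lemma scaledS a : scaled a -> scaled (fun n => (a n).+1).
Proof. by move=> ha; apply: scaled_le (scaledD ha (scaled_const 1)) => n; rewrite addn1. Qed.

Create HintDb scaled.
#[global] Hint Resolve scaled_const scaledM scaledD scaledS : scaled.

Definition fbool (b : nat -> bfun) : Prop :=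
  exists2 p, scaled p & forall n, rcx [::] (b n) (p n).

Definition fstream (g : nat -> stream -> stream) : Prop :=
  exists2 p, scaled p & forall n i, rcx [::] (fun s => g n s i) (p n).

(** Lengths, not values, are bounded by 2^O(n), so numbers as large as N with ||N|| = n are
    included. One bound [p] serves for the length and for the circuits of the bits. *)
Definition fnum (f : nat -> stream -> nat) : Prop :=
  exists2 p, scaled p & (forall n s, f n s < 2 ^ p n) /\
    forall n i, rcx [::] (fun s => testbit (f n s) i) (p n).

Lemma fnumI T p f : scaled T -> scaled p -> (forall n s, f n s < 2 ^ T n) ->
  (forall n i, i < T n -> rcx [::] (fun s => testbit (f n s) i) (p n)) -> fnum f.
Proof.
move=> hT hp b h; exists (fun n => T n + p n + 1); first by auto with scaled.
split=> [n s|n i]; first by apply: leq_trans (b n s) _; rewrite leq_exp2l //; lia.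
by apply: rcx_mono (rcx_bits_small (b n) (h n) i) _; lia.
Qed.

Lemma fbool_comp b g : fbool b -> fstream g -> fbool (fun n s => b n (g n s)).
Proof.
move=> [p sp hp] [q sq hq]; exists (fun n => p n * (q n + 1)); first by auto with scaled.
by move=> n; apply: rcx_subst.
Qed.

Lemma fstream_comp h g : fstream h -> fstream g -> fstream (fun n s => h n (g n s)).
Proof.
move=> [p sp hp] [q sq hq]; exists (fun n => p n * (q n + 1)); first by auto with scaled.
by move=> n i; apply: (rcx_subst (hp n i)).
Qed.

Lemma fnum_comp f g : fnum f -> fstream g -> fnum (fun n s => f n (g n s)).
Proof.
move=> [p sp [bp hp]] [q sq hq].
apply: (@fnumI p (fun n => p n * (q n + 1))) => //; auto with scaled.
by move=> n i _; apply: (rcx_subst (hp n i)).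
Qed.

Lemma fbool_const b : fbool (fun n _ => b n).
Proof. by exists (fun=> 1) => [|n]; [exact: scaled_const | exact: rcx_const]. Qed.

Lemma fstream_reindex (r : nat -> nat) : fstream (fun _ s i => s (r i)).
Proof. by exists (fun=> 1) => [|n i]; [exact: scaled_const | exact: rcx_var]. Qed.

Lemma fstream_id : fstream (fun _ s => s).
Proof. exact: (fstream_reindex id). Qed.

Lemma fnum_const T f : scaled T -> (forall n, f n < 2 ^ T n) -> fnum (fun n _ => f n).
Proof.
move=> sT h; apply: (@fnumI T (fun=> 1)) => //; first exact: scaled_const.
by move=> n i _; exact: rcx_const.
Qed.

Lemma fnum_cst k : fnum (fun _ _ => k).
Proof. by apply: (@fnum_const (fun=> k)); [exact: scaled_const | move=> n; exact: ltn_expl]. Qed.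

Lemma fbool_and a b : fbool a -> fbool b -> fbool (fun n s => a n s && b n s).
Proof.
move=> [p sp hp] [q sq hq]; eexists; last by move=> n; exact: rcx_and (hp n) (hq n).
by auto with scaled.
Qed.

Lemma fbool_if c a b : fbool c -> fbool a -> fbool b ->
  fbool (fun n s => if c n s then a n s else b n s).
Proof.
move=> [p sp hp] [q sq hq] [r sr hr]; eexists; last first.
  by move=> n; exact: rcx_if (hp n) (hq n) (hr n).
by auto 10 with scaled.
Qed.

Lemma fstream_if c a b : fbool c -> fstream a -> fstream b ->
  fstream (fun n s => if c n s then a n s else b n s).
Proof.
move=> [p sp hp] [q sq hq] [r sr hr].
exists (fun n => 2 * p n + q n + r n + 4); first by auto 10 with scaled.
move=> n i; apply: rcx_eqf (rcx_if (hp n) (hq n i) (hr n i)) => s.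
by case: (c n s).
Qed.

Lemma fnum_if c a b : fbool c -> fnum a -> fnum b ->
  fnum (fun n s => if c n s then a n s else b n s).
Proof.
move=> [p sp hp] [q sq [bq hq]] [r sr [br hr]].
apply: (@fnumI (fun n => q n + r n) (fun n => 2 * p n + q n + r n + 4)); auto 10 with scaled.
  move=> n s; case: (c n s); [apply: leq_trans (bq n s) _ | apply: leq_trans (br n s) _];
  by rewrite leq_exp2l //; lia.
move=> n i _; apply: rcx_eqf (rcx_if (hp n) (hq n i) (hr n i)) => s.
by case: (c n s).
Qed.

Lemma fbool_leq f g : fnum f -> fnum g -> fbool (fun n s => f n s <= g n s).
Proof.
move=> [p sp [bp hp]] [q sq [bq hq]].
exists (fun n => (p n + q n + 1) * (4 * p n + 5 * q n + 20)); first by auto 10 with scaled.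
move=> n; apply: rcx_leq (hp n) (hq n) => s.
  by apply: leq_trans (bp n s) _; rewrite leq_exp2l //; lia.
by apply: leq_trans (bq n s) _; rewrite leq_exp2l //; lia.
Qed.

Lemma fbool_eqn f g : fnum f -> fnum g -> fbool (fun n s => f n s == g n s).
Proof.
move=> hf hg; have [p sp hp] := fbool_and (fbool_leq hf hg) (fbool_leq hg hf).
by exists p => // n; apply: rcx_eqf (hp n) => s; rewrite eqn_leq.
Qed.

Lemma fnumD f g : fnum f -> fnum g -> fnum (fun n s => f n s + g n s).
Proof.
move=> [p sp [bp hp]] [q sq [bq hq]].
apply: (@fnumI (fun n => p n + q n + 1)
  (fun n => (p n + q n + 1 + 6) * (10 * p n + 10 * q n + 50))); auto 10 with scaled.
  move=> n s; rewrite addn1 expnS expnD; have := bp n s; have := bq n s.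
  have : 0 < 2 ^ p n by rewrite expn_gt0.
  have : 0 < 2 ^ q n by rewrite expn_gt0.
  nia.
by move=> n i iT; apply: rcx_addn (hp n) (hq n) _ iT.
Qed.

Lemma fnumM f g : fnum f -> fnum g -> fnum (fun n s => f n s * g n s).
Proof.
move=> [p sp [bp hp]] [q sq [bq hq]].
apply: (@fnumI (fun n => p n + q n) (fun n => (p n + q n) * 1 + q n * ((p n + q n) *
      ((p n + q n + 6) * (10 * 1 + 10 * (p n + q n + 1) + 50))))); auto 20 with scaled.
  by move=> n s; rewrite expnD; have := bp n s; have := bq n s; nia.
by move=> n i iT; apply: rcx_muln (bp n) (bq n) (hp n) (hq n) _ iT.
Qed.

Lemma fnum_half f : fnum f -> fnum (fun n s => (f n s)./2).
Proof.
move=> [p sp [bp hp]]; apply: (@fnumI p p) => // n.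
  by move=> s; apply: leq_ltn_trans (bp n s); rewrite -divn2 leq_div.
by move=> i _; apply: rcx_eqf (hp n i.+1) => s; rewrite testbit_half.
Qed.

Lemma fnum_bitlen f : fnum f -> fnum (fun n s => bitlen (f n s)).
Proof.
move=> [p sp [bp hp]].
have hb n s : bitlen (f n s) < (p n).+1 by rewrite ltnS bitlen_leq.
apply: (@fnumI (fun n => (p n).+1)
  (fun n => (p n).+1 * ((2 * p n * (p n + 1) + 10) + 1 + 2) + 1)); auto 20 with scaled.
  by move=> n s; apply: ltn_trans (hb n s) _; exact: ltn_expl.
move=> n i _.
apply: (@rcx_lookup [::] (fun s => bitlen (f n s)) (fun k _ => testbit k i)) => [//|k _|k].
  exact: rcx_bitlen_eq (bp n) (hp n).
exact: rcx_const.
Qed.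

(** The value is a power of two, so its bit [i] is the test that the product of the lengths is [i],
    done by nested look-ups on the two lengths. *)
Lemma fnum_smash f g : fnum f -> fnum g ->
  fnum (fun n s => 2 ^ (bitlen (f n s) * bitlen (g n s))).
Proof.
move=> [p sp [bp hp]] [q sq [bq hq]].
have hf n s : bitlen (f n s) < (p n).+1 by rewrite ltnS bitlen_leq.
have hg n s : bitlen (g n s) < (q n).+1 by rewrite ltnS bitlen_leq.
apply: (@fnumI (fun n => (p n).+1 * (q n).+1)
  (fun n => (p n).+1 * ((2 * p n * (p n + 1) + 10) +
     ((q n).+1 * ((2 * q n * (q n + 1) + 10) + 1 + 2) + 1) + 2) + 1)); auto 20 with scaled.
  by move=> n s; rewrite ltn_exp2l //; have := hf n s; have := hg n s; nia.
move=> n i _.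
apply: (@rcx_eqf _ (fun s => (bitlen (f n s) * bitlen (g n s)) == i)).
  by move=> s; rewrite testbit_exp2 eq_sym.
apply: (@rcx_lookup [::] (fun s => bitlen (f n s)) (fun k s => k * bitlen (g n s) == i)) => [//|k _|k].
  exact: rcx_bitlen_eq (bp n) (hp n).
apply: (@rcx_lookup [::] (fun s => bitlen (g n s)) (fun l s => k * l == i)) => [//|l _|l].
  exact: rcx_bitlen_eq (bq n) (hq n).
exact: rcx_const.
Qed.

(** * Environments of feasible functions, forcing and its soundness *)

Definition env := nat -> nat -> stream -> nat.

Definition env_at (e : env) (n : nat) (s : stream) : nat -> nat := fun i => e i n s.

Definition econs (f : nat -> stream -> nat) (e : env) : env :=
  fun i => if i is j.+1 then e j else f.

Definition ecomp (e : env) (g : nat -> stream -> stream) : env :=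
  fun i n s => e i n (g n s).

Definition esub (s : nat -> term) (e : env) : env :=
  fun i n x => teval (env_at e n x) (s i).

Definition fenv (e : env) : Prop := forall i, fnum (e i).

Lemma env_at_cons f e n s : env_at (econs f e) n s = scons (f n s) (env_at e n s).
Proof. by apply: funext; case. Qed.

Lemma ecomp_cons f e g :
  ecomp (econs f e) g = econs (fun n s => f n (g n s)) (ecomp e g).
Proof. by apply: funext; case. Qed.

Lemma fenv_cons f e : fnum f -> fenv e -> fenv (econs f e).
Proof. by move=> hf he; case. Qed.

Lemma fenv_comp e g : fenv e -> fstream g -> fenv (ecomp e g).
Proof. by move=> he hg i; exact: fnum_comp. Qed.

Lemma fnum_teval e t : fenv e -> fnum (fun n s => teval (env_at e n s) t).
Proof.
move=> he; elim: t => /= [i||t IH|t IHt u IHu|t IHt u IHu|t IHt u IHu|t IH|t IH].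
- exact: he.
- exact: fnum_cst.
- have -> : (fun n s => (teval (env_at e n s) t).+1) = (fun n s => teval (env_at e n s) t + 1).
    by do 2 apply: funext => ?; rewrite addn1.
  by apply: fnumD => //; exact: fnum_cst.
- exact: fnumD.
- exact: fnumM.
- exact: fnum_smash.
- exact: fnum_half.
- exact: fnum_bitlen.
Qed.

Lemma teval_subst e sg t : teval e (tsubst sg t) = teval (fun i => teval e (sg i)) t.
Proof. by elim: t => //= [t ->|t -> u ->|t -> u ->|t -> u ->|t ->|t ->]. Qed.

Lemma teval_shift a e t : teval (scons a e) (tshift t) = teval e t.
Proof. exact: teval_subst. Qed.

Lemma sat_subst e sg A : sat e (fsubst sg A) <-> sat (fun i => teval e (sg i)) A.
Proof.
elim: A e sg => [t u|t u||A IHA B IHB|A IHA B IHB|A IHA B IHB|A IH|A IH] e sg //=.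
- by rewrite !teval_subst.
- by rewrite !teval_subst.
- by rewrite IHA IHB.
- by rewrite IHA IHB.
- by rewrite IHA IHB.
- split=> H a; have := H a; rewrite IH; congr sat; apply: funext; case=> //= i;
  by rewrite teval_shift.
- split=> -[a H]; exists a; move: H; rewrite IH; congr sat; apply: funext; case=> //= i;
  by rewrite teval_shift.
Qed.

(** A stage is an arbitrary set of pairs of a size parameter and an input; feasibility is imposed on
    maps between stages, witnesses and case distinctions. *)
Definition world := nat -> stream -> Prop.

(* Kripke-Joyal forcing over nonuniform circuit families: disjunctions are
   decided and existential witnesses are computed by small circuits.  The first
   conjunct of the clause for [Imp] makes forced formulas true. *)
Fixpoint force (S : world) (e : env) (A : formula) : Prop :=
  match A with
  | Eq t u => forall n s, S n s -> teval (env_at e n s) t = teval (env_at e n s) u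
  | Le t u => forall n s, S n s -> teval (env_at e n s) t <= teval (env_at e n s) u
  | Bot => forall n s, ~ S n s
  | And A B => force S e A /\ force S e B
  | Or A B => exists b, [/\ fbool b, force (fun n s => S n s /\ b n s) e A
                          & force (fun n s => S n s /\ ~~ b n s) e B]
  | Imp A B => (forall n s, S n s -> sat (env_at e n s) (Imp A B)) /\
      forall g S', fstream g -> (forall n s, S' n s -> S n (g n s)) ->
        force S' (ecomp e g) A -> force S' (ecomp e g) B
  | All A => forall g S' f, fstream g -> (forall n s, S' n s -> S n (g n s)) ->
        fnum f -> force S' (econs f (ecomp e g)) A
  | Ex A => exists2 f, fnum f & force S (econs f e) A
  end.

Lemma force_agree A S e e' : (forall i n s, S n s -> e i n s = e' i n s) ->
  force S e A -> force S e' A.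
Proof.
have at_eq n s (S0 : world) (e0 e0' : env) :
    (forall i n s, S0 n s -> e0 i n s = e0' i n s) -> S0 n s ->
    env_at e0 n s = env_at e0' n s.
  by move=> h hs; apply: funext => i; exact: h.
elim: A S e e' => [t u|t u||A IHA B IHB|A IHA B IHB|A IHA B IHB|A IH|A IH] S e e' h //=.
- by move=> H n s hs; rewrite -(at_eq n s _ _ _ h hs); exact: H.
- by move=> H n s hs; rewrite -(at_eq n s _ _ _ h hs); exact: H.
- by move=> [HA HB]; split; [exact: IHA HA | exact: IHB HB].
- move=> [b [hb HA HB]]; exists b; split=> //.
    by apply: IHA HA => i n s [hs _]; exact: h.
  by apply: IHB HB => i n s [hs _]; exact: h.
- move=> [H1 H2]; split=> [n s hs|g S' hg sub HA].
    by rewrite -(at_eq n s _ _ _ h hs); exact: H1.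
  apply: IHB (H2 g S' hg sub (IHA _ _ _ _ HA)) => i n s hs; first exact/h/sub.
  exact/esym/h/sub.
- move=> H g S' f hg sub hf; apply: IH (H g S' f hg sub hf) => -[//|i] n s hs.
  exact/h/sub.
- by move=> [f hf H]; exists f => //; apply: IH H => -[//|i] n s hs; exact: h.
Qed.

Lemma force_mono A S S' g e : fstream g -> (forall n s, S' n s -> S n (g n s)) ->
  force S e A -> force S' (ecomp e g) A.
Proof.
elim: A S S' g e => [t u|t u||A IHA B IHB|A IHA B IHB|A IHA B IHB|A IH|A IH] S S' g e hg sub //=.
- by move=> H n s /sub; exact: H.
- by move=> H n s /sub; exact: H.
- by move=> H n s /sub; exact: H.
- by move=> [HA HB]; split; [exact: IHA hg sub HA | exact: IHB hg sub HB].
- move=> [b [hb HA HB]]; exists (fun n s => b n (g n s)); split; first exact: fbool_comp.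
    by apply: IHA HA => // n s [/sub].
  by apply: IHB HB => // n s [/sub].
- move=> [H1 H2]; split=> [n s /sub|g' S'' hg' sub' HA]; first exact: H1.
  apply: (H2 (fun n s => g n (g' n s))) => //; first exact: fstream_comp.
  by move=> n s /sub' /sub.
- move=> H g' S'' f hg' sub' hf; apply: (H (fun n s => g n (g' n s))) => //.
    exact: fstream_comp.
  by move=> n s /sub' /sub.
- move=> [f hf H]; exists (fun n s => f n (g n s)); first exact: fnum_comp.
  by rewrite -ecomp_cons; exact: IH H.
Qed.

Lemma force_restrict A (S S' : world) e :
  (forall n s, S' n s -> S n s) -> force S e A -> force S' e A.
Proof. by move=> sub; exact: (force_mono fstream_id). Qed.

(** Forcing is local: the data on the two halves are merged by a conditional on [b]. Disjunction
    elimination rests on this. *)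
Lemma force_glue A (S : world) b e : fbool b ->
  force (fun n s => S n s /\ b n s) e A -> force (fun n s => S n s /\ ~~ b n s) e A ->
  force S e A.
Proof.
elim: A S b e => [t u|t u||A IHA B IHB|A IHA B IHB|A IHA B IHB|A IH|A IH] S b e hb /=.
- by move=> H1 H2 n s hs; case bs: (b n s); [apply: H1 | apply: H2]; rewrite ?bs.
- by move=> H1 H2 n s hs; case bs: (b n s); [apply: H1 | apply: H2]; rewrite ?bs.
- by move=> H1 H2 n s hs; case bs: (b n s); [apply: (H1 n s) | apply: (H2 n s)]; rewrite ?bs.
- by move=> [HA1 HB1] [HA2 HB2]; split; [exact: IHA hb HA1 HA2 | exact: IHB hb HB1 HB2].
- move=> [b1 [hb1 HA1 HB1]] [b2 [hb2 HA2 HB2]].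
  exists (fun n s => if b n s then b1 n s else b2 n s); split; first exact: fbool_if.
    apply: (IHA _ b) => //.
      by apply: force_restrict HA1 => n s [[hs +] bs]; rewrite bs.
    by apply: force_restrict HA2 => n s [[hs +] bs]; rewrite (negbTE bs).
  apply: (IHB _ b) => //.
    by apply: force_restrict HB1 => n s [[hs +] bs]; rewrite bs.
  by apply: force_restrict HB2 => n s [[hs +] bs]; rewrite (negbTE bs).
- move=> [H1 H2] [H3 H4]; split=> [n s hs|g S' hg sub HA].
    by case bs: (b n s); [apply: H1 | apply: H3]; rewrite ?bs.
  apply: (IHB _ (fun n s => b n (g n s))); first exact: fbool_comp.
    by apply: H2 => // [n s [/sub ? ?] //|]; apply: force_restrict HA => n s [].
  by apply: H4 => // [n s [/sub ? ?] //|]; apply: force_restrict HA => n s [].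
- move=> H1 H2 g S' f hg sub hf.
  apply: (IH _ (fun n s => b n (g n s))); first exact: fbool_comp.
    by apply: H1 => // n s [/sub].
  by apply: H2 => // n s [/sub].
- move=> [f1 hf1 H1] [f2 hf2 H2].
  exists (fun n s => if b n s then f1 n s else f2 n s); first exact: fnum_if.
  apply: (IH _ b) => //.
    by apply: force_agree H1 => -[|i] n s [_ /= bs] //; rewrite bs.
  by apply: force_agree H2 => -[|i] n s [_ /= bs] //; rewrite (negbTE bs).
Qed.

(** Implication is the case where induction fails, since a true premise may be unforced; the first
    conjunct of its clause settles it. *)
Lemma force_sat A S e n s : force S e A -> S n s -> sat (env_at e n s) A.
Proof.
elim: A S e n s => [t u|t u||A IHA B IHB|A IHA B IHB|A IHA B IHB|A IH|A IH] S e n s //=.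
- by move=> H; exact: H.
- by move=> H; exact: H.
- by move=> H; exact: H.
- by move=> [HA HB] hs; split; [exact: IHA HA _ | exact: IHB HB _].
- move=> [b [hb HA HB]] hs; case bs: (b n s).
    by left; apply: IHA HA _.
  by right; apply: IHB HB _; rewrite bs.
- by move=> [H _] hs; exact: H.
- move=> H hs a; have := H _ (fun n' s' => n' = n /\ s' = s) _ fstream_id _ (fnum_cst a).
  move/(_ _)/IH => /(_ n s); rewrite env_at_cons; apply=> //.
  by move=> _ _ [-> ->].
- by move=> [f hf H] hs; exists (f n s); rewrite -env_at_cons; exact: IH H _.
Qed.

Lemma force_empty A (S : world) e : (forall n s, ~ S n s) -> force S e A.
Proof.
elim: A S e => [t u|t u||A IHA B IHB|A IHA B IHB|A IHA B IHB|A IH|A IH] S e h //=.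
- by move=> n s /h.
- by move=> n s /h.
- by split; [exact: IHA | exact: IHB].
- exists (fun _ _ => true); split; first exact: (fbool_const (fun=> true)).
    by apply: IHA => n s [/h].
  by apply: IHB => n s [/h].
- split=> [n s /h //|g S' _ sub _]; apply: IHB => n s /sub; exact: h.
- by move=> g S' f _ sub _; apply: IH => n s /sub; exact: h.
- by exists (fun _ _ => 0); [exact: fnum_cst | exact: IH].
Qed.

Lemma esub_up sg f e : esub (up sg) (econs f e) = econs f (esub sg e).
Proof.
apply: funext; case=> // i; do 2 apply: funext => ?.
by rewrite /esub env_at_cons /= teval_shift.
Qed.

Lemma force_subst A S e sg : force S e (fsubst sg A) <-> force S (esub sg e) A.
Proof.
elim: A S e sg => [t u|t u||A IHA B IHB|A IHA B IHB|A IHA B IHB|A IH|A IH] S e sg //=.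
- by split=> H n s hs; have := H n s hs; rewrite !teval_subst.
- by split=> H n s hs; have := H n s hs; rewrite !teval_subst.
- by rewrite IHA IHB.
- by split=> -[b [hb HA HB]]; exists b; split=> //; [apply/IHA | apply/IHB | apply/IHA | apply/IHB].
- split=> -[H1 H2]; split.
  + by move=> n s hs; have := H1 n s hs; rewrite !sat_subst.
  + by move=> g S' hg sub /IHA HA; apply/IHB; exact: H2.
  + by move=> n s hs; have := H1 n s hs; rewrite !sat_subst.
  + by move=> g S' hg sub /IHA HA; apply/IHB; exact: H2.
- split=> H g S' f hg sub hf.
    have /IH := H g S' f hg sub hf; by rewrite esub_up.
  by apply/IH; rewrite esub_up; exact: H.
- split=> -[f hf H]; exists f => //; first by have /IH := H; rewrite esub_up.
  by apply/IH; rewrite esub_up.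
Qed.

Lemma force_subst0 S e t A :
  force S e (subst0 t A) <-> force S (econs (fun n s => teval (env_at e n s) t) e) A.
Proof.
rewrite /subst0 force_subst.
by have -> : esub (fun i => if i is j.+1 then Var j else t) e =
  econs (fun n s => teval (env_at e n s) t) e by apply: funext; case.
Qed.

Lemma force_shift S f e A : force S (econs f e) (fshift A) <-> force S e A.
Proof. exact: force_subst. Qed.

Lemma sat_subst0 e t A : sat e (subst0 t A) <-> sat (scons (teval e t) e) A.
Proof.
rewrite sat_subst.
by have -> : (fun i => teval e (if i is j.+1 then Var j else t)) = scons (teval e t) e
  by apply: funext; case.
Qed.

Lemma sat_shift a e A : sat (scons a e) (fshift A) <-> sat e A.
Proof. exact: sat_subst. Qed.

Lemma prv_sat Ax : (forall A e, Ax A -> sat e A) ->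
  forall G A, prv Ax G A -> forall e, (forall B, List.In B G -> sat e B) -> sat e A.
Proof.
move=> hAx G A; elim=> {G A}.
- by move=> G A /hAx H e _; exact: H.
- by move=> G A H e; apply.
- by move=> G A _ IH e /IH.
- by move=> G A B _ IHA _ IHB e h; split; [exact: IHA | exact: IHB].
- by move=> G A B _ IH e /IH [].
- by move=> G A B _ IH e /IH [].
- by move=> G A B _ IH e /IH; left.
- by move=> G A B _ IH e /IH; right.
- move=> G A B C _ IH _ IHA _ IHB e h; case: (IH e h) => H; [apply: IHA | apply: IHB];
  by move=> D [<-|/h].
- by move=> G A B _ IH e h HA; apply: IH => C [<-|/h].
- by move=> G A B _ IH1 _ IH2 e h; apply: IH1 => //; exact: IH2.
- move=> G A _ IH e h a; apply: IH => B /List.in_map_iff [C [<- /h]].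
  by rewrite sat_shift.
- by move=> G A t _ IH e h; rewrite sat_subst0; exact: IH.
- by move=> G A t _ IH e /IH; rewrite sat_subst0; exists (teval e t).
- move=> G A C _ IH1 _ IH2 e h; have [a Ha] := IH1 e h.
  rewrite -(sat_shift a); apply: IH2 => B [<- //|/List.in_map_iff [D [<- /h]]].
  by rewrite sat_shift.
- by [].
- by move=> G A t u _ IH1 _ IH2 e h; have := IH2 e h; rewrite !sat_subst0 -(IH1 e h).
Qed.

Lemma prv_force Ax : (forall A e, Ax A -> sat e A) ->
  (forall A S e, Ax A -> fenv e -> force S e A) ->
  forall G A, prv Ax G A -> forall S e, fenv e ->
    (forall B, List.In B G -> force S e B) -> force S e A.
Proof.
move=> sAx fAx G A; elim=> {G A}.
- by move=> G A H S e he _; exact: fAx.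
- by move=> G A H S e _; apply.
- by move=> G A _ IH S e he /IH H; apply: force_empty; exact: H.
- by move=> G A B _ IHA _ IHB S e he h; split; [exact: IHA | exact: IHB].
- by move=> G A B _ IH S e he /IH [].
- by move=> G A B _ IH S e he /IH [].
- move=> G A B _ IH S e he h; exists (fun _ _ => true); split.
  + exact: (fbool_const (fun=> true)).
  + by apply: force_restrict (IH S e he h) => n s [].
  + by apply: force_empty => n s [].
- move=> G A B _ IH S e he h; exists (fun _ _ => false); split.
  + exact: (fbool_const (fun=> false)).
  + by apply: force_empty => n s [].
  + by apply: force_restrict (IH S e he h) => n s [].
- move=> G A B C _ IH _ IHA _ IHB S e he h; have [b [hb HA HB]] := IH S e he h.
  have h' (S' : world) : (forall n s, S' n s -> S n s) -> forall D, List.In D G -> force S' e D.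
    by move=> sub D /h; exact: force_restrict.
  apply: (force_glue hb).
    by apply: IHA => // D [<- //|]; apply: h' => n s [].
  by apply: IHB => // D [<- //|]; apply: h' => n s [].
(* For the truth conjunct: forced hypotheses are true, so soundness of the derivation in the
   standard model applies. *)
- move=> G A B dB IH S e he h; split=> [n s hs HA|g S' hg sub HA].
    apply: (prv_sat sAx dB) => C [<- //|/h H]; exact: force_sat H hs.
  apply: IH; first exact: fenv_comp.
  by move=> C [<- //|/h]; exact: force_mono.
- move=> G A B _ IH1 _ IH2 S e he h; have [_ H] := IH1 S e he h.
  by apply: (H _ S fstream_id) => //; exact: IH2.
- move=> G A _ IH S e he h g S' f hg sub hf; apply: IH.
    by apply: fenv_cons => //; exact: fenv_comp.
  move=> B /List.in_map_iff [C [<- /h HC]]; rewrite force_shift; exact: force_mono HC.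
- move=> G A t _ IH S e he h; rewrite force_subst0.
  by apply: (IH S e he h _ S _ fstream_id) => //; exact: fnum_teval.
- move=> G A t _ IH S e he /IH; rewrite force_subst0 => H.
  by exists (fun n s => teval (env_at e n s) t); [exact: fnum_teval | exact: H].
- move=> G A C _ IH1 _ IH2 S e he h; have [f hf H] := IH1 S e he h.
  rewrite -(force_shift S f); apply: IH2; first exact: fenv_cons.
  by move=> B [<- //|/List.in_map_iff [D [<- /h]]]; rewrite force_shift.
- by [].
- move=> G A t u _ IH1 _ IH2 S e he h; have := IH2 S e he h; rewrite !force_subst0.
  by apply: force_agree => -[|//] n s hs; exact: (IH1 S e he h).
Qed.

(** * Realizability of bounded formulas and polynomial induction *)

Lemma bitlen0 : bitlen 0 = 0.
Proof. by apply/eqP; rewrite -leqn0 bitlen_leq. Qed.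

Lemma bitlen_eqP x k : 2 ^ k <= x -> x < 2 ^ k.+1 -> bitlen x = k.+1.
Proof. by move=> h1 h2; apply/eqP; rewrite eqn_leq bitlen_leq h2 ltnNge bitlen_leq -leqNgt. Qed.

Lemma bitlen_gt0 x : 0 < x -> exists2 k, bitlen x = k.+1 & 2 ^ k <= x < 2 ^ k.+1.
Proof.
move=> hx; case E: (bitlen x) => [|k].
  by have : bitlen x <= 0 by [rewrite E]; rewrite bitlen_leq; lia.
exists k => //; rewrite -bitlen_leq E leqnn andbT leqNgt -bitlen_leq E.
by rewrite ltnn.
Qed.

Lemma bitlen_exp2 k : bitlen (2 ^ k) = k.+1.
Proof. by apply: bitlen_eqP; rewrite // ltn_exp2l. Qed.

Lemma bitlen_double x b : 0 < 2 * x + b -> b <= 1 -> bitlen (2 * x + b) = (bitlen x).+1.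
Proof.
move=> h hb; have [x0|x0] := posnP x.
  have -> : b = 1 by rewrite x0 in h; lia.
  by rewrite x0 bitlen0; apply: bitlen_eqP.
by have [k -> hk] := bitlen_gt0 x0; apply: bitlen_eqP; rewrite !expnS in hk *; lia.
Qed.

Lemma bitlen_half x : 0 < x -> bitlen x = (bitlen x./2).+1.
Proof.
move=> hx; have E := odd_double_half x; rewrite -{1}E addnC -mul2n.
by rewrite bitlen_double //; [rewrite mul2n addnC E | case: (odd x)].
Qed.

Lemma leq_bitlen x y : x <= y -> bitlen x <= bitlen y.
Proof. by move=> h; rewrite bitlen_leq (leq_ltn_trans h) // ltn_bitlen. Qed.

Lemma sat_BASIC A e : List.In A BASIC_axioms -> sat e A.
Proof.
have b1 : bitlen 1 = 1 by apply: bitlen_eqP.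
have bd x : x <> 0 -> bitlen (2 * x) = (bitlen x).+1.
  by move=> h; rewrite -[2 * x]addn0 bitlen_double //; lia.
have bd1 x : bitlen (2 * x).+1 = (bitlen x).+1.
  by rewrite -addn1 bitlen_double //; lia.
move=> /= H; repeat (case: H => [<-|H]).
all: rewrite /= ?bitlen0 ?b1 ?bitlen_exp2 ?mul0n ?mul1n //.
- lia.
- lia.
- by split=> [[h1 h2]|h]; [rewrite ltn_neqAle h1 andbT; apply/eqP | split; [exact: ltnW | lia]].
- lia.
- lia.
- lia.
- lia.
- by move=> /bd ->; rewrite bd1.
- exact: leq_bitlen.
- by move=> /bd ->; rewrite bd1 expnS.
- by rewrite mulnC.
- by move=> ->.
- by move=> ->; rewrite mulnDl expnD.
- lia.
- by move=> [h1 h2]; split; lia.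
- lia.
- lia.
- lia.
- lia.
- by split; rewrite leq_add2l.
- lia.
- lia.
- lia.
- lia.
- by move=> h; split; rewrite leq_pmul2l.
- by move=> h; apply: bitlen_half; lia.
- split; lia.
Qed.

Fixpoint qfree (A : formula) : bool :=
  match A with
  | Eq _ _ | Le _ _ | Bot => true
  | And A B | Or A B | Imp A B => qfree A && qfree B
  | All _ | Ex _ => false
  end.

Lemma fbool_sat A e : qfree A -> fenv e ->
  exists2 b, fbool b & forall n s, sat (env_at e n s) A <-> b n s.
Proof.
move=> + he; elim: A => //= [t u _|t u _|_|A IHA B IHB /andP [/IHA [a ha EA] /IHB [b hb EB]]|A IHA B IHB /andP [/IHA [a ha EA] /IHB [b hb EB]]|A IHA B IHB /andP [/IHA [a ha EA] /IHB [b hb EB]]].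
- exists (fun n s => teval (env_at e n s) t == teval (env_at e n s) u).
    by apply: fbool_eqn; exact: fnum_teval.
  by move=> n s; split=> /eqP.
- exists (fun n s => teval (env_at e n s) t <= teval (env_at e n s) u) => //.
  by apply: fbool_leq; exact: fnum_teval.
- by exists (fun _ _ => false) => //; exact: (fbool_const (fun=> false)).
- exists (fun n s => if a n s then b n s else false).
    by apply: fbool_if => //; exact: (fbool_const (fun=> false)).
  by move=> n s; rewrite EA EB; case: (a n s); split=> // -[].
- exists (fun n s => if a n s then true else b n s).
    by apply: fbool_if => //; exact: (fbool_const (fun=> true)).
  by move=> n s; rewrite EA EB; case: (a n s); split; auto => -[].
- exists (fun n s => if a n s then b n s else true).
    by apply: fbool_if => //; exact: (fbool_const (fun=> true)).
  by move=> n s; rewrite EA EB; case: (a n s); split; auto.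
Qed.

(** A feasible circuit decides a quantifier-free formula, and this is the case distinction that a
    disjunction asks for. The basic axioms are forced for this reason. *)
Lemma force_qfree A S e : qfree A -> fenv e ->
  (forall n s, S n s -> sat (env_at e n s) A) -> force S e A.
Proof.
elim: A S e => //= [A IHA B IHB|A IHA B IHB|A IHA B IHB] S e /andP [qA qB] he H.
- by split; [apply: IHA | apply: IHB] => // n s /H [].
- have [b hb Eb] := fbool_sat qA he; exists b; split=> //.
    by apply: IHA => // n s [_ /Eb].
  by apply: IHB => // n s [/H [/Eb ->|//]].
- split=> [//|g S' hg sub HA]; apply: IHB => // [|n s hs]; first exact: fenv_comp.
  by apply: (H n (g n s)); [exact: sub | exact: (force_sat HA)].
Qed.

Lemma sat_PIND A e : sat e (PIND A).
Proof.
move=> [/sat_subst0 H0 HS] x; elim/ltn_ind: x => x IH.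
have [->//|x0] := posnP x.
apply: (HS x); apply/sat_subst.
have -> : (fun i => teval (scons x e) (if i is 0 then Half (Var 0) else Var i)) = scons x./2 e.
  by apply: funext; case.
by apply: IH; lia.
Qed.

Lemma sat_IS12 A e : IS12 A -> sat e A.
Proof. by case=> {A} A => [/sat_BASIC|_]; [apply | exact: sat_PIND]. Qed.

(** * Realizers: coding pairs and families of streams *)

Definition spair (s w : stream) : stream := fun i => if odd i then w i./2 else s i./2.
Definition sfst (s : stream) : stream := fun i => s i.*2.
Definition ssnd (s : stream) : stream := fun i => s i.*2.+1.

Lemma spairK1 s w : sfst (spair s w) = s.
Proof. by apply: funext => i; rewrite /sfst /spair odd_double doubleK. Qed.

Lemma spairK2 s w : ssnd (spair s w) = w.
Proof. by apply: funext => i; rewrite /ssnd /spair /= odd_double uphalf_double. Qed.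

Lemma fstream_fst : fstream (fun _ => sfst).
Proof. exact: fstream_reindex. Qed.

Lemma fstream_snd : fstream (fun _ => ssnd).
Proof. exact: fstream_reindex. Qed.

Lemma rcx_spair L (g h : stream -> stream) p q :
  (forall i, rcx L (fun s => g s i) p) -> (forall i, rcx L (fun s => h s i) q) ->
  forall i, rcx L (fun s => spair (g s) (h s) i) (p + q).
Proof.
move=> hg hh i; rewrite /spair; case: (odd i).
  by apply: rcx_mono (hh _) _; lia.
by apply: rcx_mono (hg _) _; lia.
Qed.

Lemma fstream_pair g h : fstream g -> fstream h -> fstream (fun n s => spair (g n s) (h n s)).
Proof.
move=> [p sp hp] [q sq hq]; exists (fun n => p n + q n); first by auto with scaled.
by move=> n; exact: rcx_spair.
Qed.

Lemma fstream_testbit f : fnum f -> fstream (fun n s => testbit (f n s)).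
Proof. by move=> [p sp [_ hp]]; exists p. Qed.

Lemma fnum_ofbits T g : scaled T -> fstream g -> fnum (fun n s => ofbits (T n) (g n s)).
Proof.
move=> sT [p sp hp]; apply: (@fnumI T p) => // [n s|n i iT]; first exact: ofbits_lt.
by apply: rcx_eqf (hp n i) => s; rewrite testbit_ofbits iT.
Qed.

(** The integer square root of the value is x + i, so this is a pairing; being polynomial, it keeps
    2^O(n) positions within 2^O(n). *)
Definition idx (x i : nat) : nat := (x + i) ^ 2 + i.

Lemma idx_inj x i y j : idx x i = idx y j -> x = y /\ i = j.
Proof.
rewrite /idx -!mulnn => h.
suff E : x + i = y + j by rewrite E in h; lia.
have : x + i < y + j -> False by move=> l; have := leq_mul l l; lia.
have : y + j < x + i -> False by move=> l; have := leq_mul l l; lia.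
lia.
Qed.

(** Decoding is applied to positions, which are hard-wired, so it costs no gates. *)
Definition unidx (k : nat) : nat * nat :=
  if [pick q : 'I_k.+1 * 'I_k.+1 | idx q.1 q.2 == k] is Some q
  then (q.1 : nat, q.2 : nat) else (0, 0).

Lemma idxK x i : unidx (idx x i) = (x, i).
Proof.
rewrite /unidx; case: pickP => [[y j] /= /eqP /idx_inj [-> ->] //|h].
have hx : x < (idx x i).+1 by rewrite /idx -mulnn; nia.
have hi : i < (idx x i).+1 by rewrite /idx -mulnn; nia.
by have := h (Ordinal hx, Ordinal hi); rewrite eqxx.
Qed.

(* Realizers are bit streams; a conjunct is realized by half of the stream, and
   the instance at [x] of a sharply bounded quantifier by the bits at [idx x i]. *)
Definition slice (x : nat) (w : stream) : stream := fun i => w (idx x i).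

Lemma fstream_select Z K w : fnum Z -> scaled K -> (forall n s, Z n s < K n) ->
  fstream w -> fstream (fun n s => slice (Z n s) (w n s)).
Proof.
move=> [p sp [bp hp]] sK bK [q sq hq].
exists (fun n => K n * ((p n + K n + 1) * (9 * p n + 9 * 1 + 41) + q n + 2) + 1).
  by auto 20 with scaled.
move=> n i; apply: (@rcx_lookup [::] (Z n) (fun k s => w n s (idx k i))) => [//|k kK|//].
apply: rcx_eqn => [s|s|//|j].
- by apply: leq_trans (bp n s) _; rewrite leq_exp2l //; lia.
- by apply: ltn_trans kK (leq_trans (ltn_expl _ (isT : 1 < 2)) _); rewrite leq_exp2l //; lia.
- exact: rcx_const.
Qed.

(* Realizers survive the clearing of far bits, so that an iteration only has to
   carry finitely many. *)
Definition zap (B : nat) (w w' : stream) : Prop :=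
  forall i, w' i = w i \/ (B <= i /\ w' i = false).

Lemma zap_reindex B B' w w' r : (forall i, B <= r i -> B' <= i) ->
  zap B w w' -> zap B' (fun i => w (r i)) (fun i => w' (r i)).
Proof. by move=> h z i; case: (z (r i)) => [?|[/h ? ?]]; [left | right]. Qed.

(** Forcing speaks of whole families of functions, [R] of one environment and one stream; hence [R]
    can be assumed about an additional input. [real_force] and [force_real] translate between the
    two, and [real_zap] bounds the number of bits that matter. *)
Record realizability (A : formula) (R : (nat -> nat) -> stream -> Prop) : Prop := {
  real_sat : forall e w, R e w -> sat e A;
  real_force : forall S e, fenv e -> force S e A ->
    exists2 w, fstream w & forall n s, S n s -> R (env_at e n s) (w n s);
  force_real : forall S e w, fenv e -> fstream w ->
    (forall n s, S n s -> R (env_at e n s) (w n s)) -> force S e A;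
  real_zap : forall e, fenv e -> exists2 B, scaled B & forall n s w w',
    zap (B n) w w' -> R (env_at e n s) w -> R (env_at e n s) w' }.

Lemma realizability_qfree A : qfree A -> realizability A (fun e _ => sat e A).
Proof.
move=> qA; split=> //.
- move=> S e he H; exists (fun _ s => s); first exact: fstream_id.
  by move=> n s; exact: force_sat.
- by move=> S e w he _; exact: force_qfree.
- by move=> e _; exists (fun=> 0) => //; exact: scaled_const.
Qed.

Lemma realizability_and A B RA RB : realizability A RA -> realizability B RB ->
  realizability (And A B) (fun e w => RA e (sfst w) /\ RB e (ssnd w)).
Proof.
move=> hA hB; split.
- by move=> e w [/(real_sat hA) ? /(real_sat hB) ?].
- move=> S e he [/(real_force hA he) [a fa Ha] /(real_force hB he) [b fb Hb]].
  exists (fun n s => spair (a n s) (b n s)); first exact: fstream_pair.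
  by move=> n s hs; rewrite spairK1 spairK2; split; [exact: Ha | exact: Hb].
- move=> S e w he fw H; split.
    apply: (force_real hA (w := fun n s => sfst (w n s)) he) => [|n s /H []//].
    exact: fstream_comp fstream_fst fw.
  apply: (force_real hB (w := fun n s => ssnd (w n s)) he) => [|n s /H []//].
  exact: fstream_comp fstream_snd fw.
- move=> e he; have [a sa Ha] := real_zap hA he; have [b sb Hb] := real_zap hB he.
  (* Position [i] of a half is position 2i or 2i + 1 of the stream. *)
  exists (fun n => 2 * (a n + b n) + 2); first by auto 10 with scaled.
  move=> n s w w' z [H1 H2]; split; [apply: Ha H1 | apply: Hb H2];
  by apply: zap_reindex z => i; lia.
Qed.

Lemma realizability_or A B RA RB : realizability A RA -> realizability B RB ->
  realizability (Or A B) (fun e w =>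
    if w 0 then RA e (fun i => w i.+1) else RB e (fun i => w i.+1)).
Proof.
move=> hA hB; split.
- by move=> e w; case: (w 0) => [/(real_sat hA)|/(real_sat hB)]; [left | right].
- move=> S e he [c [fc /(real_force hA he) [a fa Ha] /(real_force hB he) [b fb Hb]]].
  exists (fun n s i => if i is j.+1 then (if c n s then a n s else b n s) j else c n s).
    have [p sp hp] := fc; have [q sq hq] := fstream_if fc fa fb.
    exists (fun n => p n + q n); first by auto with scaled.
    move=> n [|i]; first by apply: rcx_mono (hp n) _; lia.
    by apply: rcx_mono (hq n i) _; lia.
  by move=> n s hs; case cs: (c n s); [apply: Ha | apply: Hb]; rewrite ?cs.
- move=> S e w he fw H.
  have fw' : fstream (fun n s i => w n s i.+1) by exact: fstream_comp (fstream_reindex succn) fw.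
  exists (fun n s => w n s 0); split.
  + by have [p sp hp] := fw; exists p.
  + by apply: (force_real hA he fw') => n s [/H + h]; rewrite h.
  + by apply: (force_real hB he fw') => n s [/H + h]; rewrite (negbTE h).
- move=> e he; have [a sa Ha] := real_zap hA he; have [b sb Hb] := real_zap hB he.
  (* The additional 1 protects bit 0, which records the chosen disjunct. *)
  exists (fun n => a n + b n + 1); first by auto 10 with scaled.
  move=> n s w w' z; have -> : w' 0 = w 0 by case: (z 0) => // -[]; lia.
  by case: (w 0); [apply: Ha | apply: Hb]; apply: zap_reindex z => i; lia.
Qed.

(* The bits of the new number are fresh input variables. *)
Definition generic (T : nat -> nat) (e : env) : env :=
  econs (fun n s => ofbits (T n) (ssnd s)) (ecomp e (fun _ => sfst)).

Lemma fenv_generic T e : scaled T -> fenv e -> fenv (generic T e).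
Proof.
move=> sT he; apply: fenv_cons; first exact: fnum_ofbits fstream_snd.
exact: fenv_comp fstream_fst.
Qed.

Lemma env_at_generic T e n s x : x < 2 ^ T n ->
  env_at (generic T e) n (spair s (testbit x)) = scons x (env_at e n s).
Proof.
move=> h; rewrite env_at_cons spairK2 ofbits_testbitK //; congr scons.
by apply: funext => i; rewrite /env_at /ecomp spairK1.
Qed.

Lemma realizability_bex t A RA : realizability A RA ->
  realizability (Ex (And (Le (Var 0) (tshift t)) A)) (fun e w =>
    exists x, [/\ x <= teval e t, sfst w = testbit x & RA (scons x e) (ssnd w)]).
Proof.
move=> hA; split.
- move=> e w [x [xt _ /(real_sat hA) H]]; exists x; split=> //=.
  by rewrite teval_shift.
- move=> S e he [f hf [Hf /(real_force hA (fenv_cons hf he)) [w fw Hw]]].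
  exists (fun n s => spair (testbit (f n s)) (w n s)).
    by apply: fstream_pair => //; exact: fstream_testbit.
  move=> n s hs; exists (f n s); rewrite spairK1 spairK2 -env_at_cons; split=> //.
    by have := Hf n s hs; rewrite /= env_at_cons teval_shift.
  exact: Hw.
- move=> S e w he fw H; have [T sT [bT _]] := fnum_teval t he.
  have E n s x : x <= teval (env_at e n s) t -> sfst (w n s) = testbit x ->
      ofbits (T n) (sfst (w n s)) = x.
    by move=> xt ->; rewrite ofbits_testbitK // (leq_ltn_trans xt).
  have hf : fnum (fun n s => ofbits (T n) (sfst (w n s))).
    by apply: fnum_ofbits => //; exact: fstream_comp fstream_fst fw.
  exists (fun n s => ofbits (T n) (sfst (w n s))) => //; split.
    move=> n s /H [x [xt Ex _]]; rewrite /= env_at_cons teval_shift /=.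
    by rewrite (E _ _ _ xt Ex).
  apply: (force_real hA (fenv_cons hf he) (fstream_comp fstream_snd fw)).
  move=> n s /H [x [xt Ex HR]]; rewrite env_at_cons (E _ _ _ xt Ex) //.
- move=> e he; have [T sT [bT _]] := fnum_teval t he.
  (* The witness [x] is an arbitrary number and not a feasible function of the input, so the bound
     for [A] is taken where the bits of [x] are inputs. *)
  have [B sB HB] := real_zap hA (fenv_generic sT he).
  exists (fun n => 2 * (T n + B n) + 2); first by auto 10 with scaled.
  move=> n s w w' z [x [xt Ex HR]]; exists x.
  have xT : x < 2 ^ T n by exact: leq_ltn_trans xt (bT n s).
  split=> //.
    apply: funext => i; rewrite -Ex /sfst; case: (z i.*2) => [//|[h ->]].
    by rewrite -[w _]/(sfst w i) Ex (testbit_small xT) //; lia.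
  rewrite -(env_at_generic _ _ xT) in HR *; apply: HB HR.
  by apply: zap_reindex z => i; lia.
Qed.

(** From forcing to realizers, [A] is realized at a generic number and the slices arise by fixing
    its bits. Conversely, the slice at a computed index is selected by a multiplexer. *)
Lemma realizability_sball t A RA : realizability A RA ->
  realizability (All (Imp (Le (Var 0) (Len (tshift t))) A)) (fun e w =>
    forall x, x <= bitlen (teval e t) -> RA (scons x e) (slice x w)).
Proof.
move=> hA.
have bound e : fenv e -> exists2 T, scaled T & forall n s x,
    x <= bitlen (teval (env_at e n s) t) -> x <= T n /\ x < 2 ^ T n.
  move=> he; have [T sT [bT _]] := fnum_teval t he; exists T => // n s x h.
  have xT : x <= T n by apply: leq_trans h _; rewrite bitlen_leq.
  by split=> //; apply: leq_ltn_trans xT (ltn_expl _ _).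
split.
- move=> e w H x /=; rewrite teval_shift => /H; exact: real_sat.
- move=> S e he H; have [T sT bT] := bound e he.
  pose S' n s := S n (sfst s) /\
    ofbits (T n) (ssnd s) <= bitlen (teval (env_at e n (sfst s)) t).
  have HA : force S' (generic T e) A.
    have := H (fun _ => sfst) S' (fun n s => ofbits (T n) (ssnd s)) fstream_fst.
    case=> [n s []//||_ H']; first exact: fnum_ofbits fstream_snd.
    apply: (H' _ S' fstream_id) => // n s [_ h].
    by rewrite -[ecomp _ _]/(generic T e) /= env_at_cons teval_shift.
  have [w fw Hw] := real_force hA (fenv_generic sT he) HA.
  exists (fun n s k => w n (spair s (testbit (unidx k).1)) (unidx k).2).
    have [p sp hp] := fw; exists (fun n => p n * (1 + 1 + 1)); first by auto 10 with scaled.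
    move=> n k; apply: rcx_subst (hp n _) _; apply: rcx_spair => i; first exact: rcx_var.
    exact: rcx_const.
  move=> n s hs x hx; have [_ xT] := bT _ _ _ hx.
  have := Hw n (spair s (testbit x)); rewrite env_at_generic //.
  have -> : slice x (fun k => w n (spair s (testbit (unidx k).1)) (unidx k).2)
       = w n (spair s (testbit x)).
    by apply: funext => i; rewrite /slice idxK.
  by apply; split; rewrite ?spairK1 ?spairK2 // ofbits_testbitK.
- move=> S e w he fw H g S' f hg hS hf; have [T sT bT] := bound e he.
  split=> [n s hs|g' S'' hg' hS' Hle].
    rewrite env_at_cons /= teval_shift => /(H _ _ (hS _ _ hs)); exact: real_sat.
  pose h n s := g n (g' n s).
  have hh : fstream h by exact: fstream_comp.
  (* Off the stage [f] may exceed the bound; the default 0 keeps the selector small on every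
     input. *)
  pose Z n s := if f n (g' n s) <= bitlen (teval (env_at e n (h n s)) t)
                then f n (g' n s) else 0.
  have hf' := fnum_comp hf hg'.
  have hZ : fnum Z.
    apply: fnum_if => //; last exact: fnum_cst.
    by apply: fbool_leq => //; exact: fnum_comp (fnum_bitlen (fnum_teval t he)) hh.
  have bZ n s : Z n s < (T n).+1.
    by rewrite ltnS /Z; case: ifP => // /bT [].
  have fw' := fstream_comp fw hh.
  have fsel := fstream_select hZ (scaledS sT) bZ fw'.
  apply: (force_real hA _ fsel).
    by apply: fenv_comp => //; apply: fenv_cons => //; exact: fenv_comp.
  move=> n s hs.
  have := Hle n s hs; rewrite ecomp_cons env_at_cons /= teval_shift => hle.
  rewrite /Z hle; exact: (H _ _ (hS _ _ (hS' _ _ hs))).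
- move=> e he; have [T sT bT] := bound e he.
  have [B sB HB] := real_zap hA (fenv_generic sT he).
  exists (fun n => (T n + B n) * (T n + B n) + B n); first by auto 10 with scaled.
  move=> n s w w' z H x hx; have [xT xT'] := bT _ _ _ hx.
  have := H x hx; rewrite -(env_at_generic _ _ xT'); apply: HB.
  apply: zap_reindex z => i; rewrite /idx -mulnn.
  by case: (leqP (B n) i) => // iB; nia.
Qed.

Lemma Sigma1bp_realizability A : Sigma1bp A -> exists R, realizability A R.
Proof.
elim=> {A} [t u|t u|A B _ [RA hA] _ [RB hB]|A B _ [RA hA] _ [RB hB]|t A _ [RA hA]|t A _ [RA hA]].
- by eexists; exact: realizability_qfree.
- by eexists; exact: realizability_qfree.
- by eexists; exact: realizability_and hA hB.
- by eexists; exact: realizability_or hA hB.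
- by eexists; exact: realizability_bex hA.
- by eexists; exact: realizability_sball hA.
Qed.

Definition trunc (B : nat) (w : stream) : stream := fun i => (i < B) && w i.

Lemma zap_trunc B w : zap B w (trunc B w).
Proof. by move=> i; rewrite /trunc; case: ltnP => h; [left | right]. Qed.

(** Truncation leaves [B n] wires of state, so [T n] rounds take T n * B n one-bit step circuits
    instead of a nesting of depth [T n]. *)
Lemma fstream_iterate (h : nat -> stream -> stream) w0 x B T p :
  scaled B -> scaled T -> scaled p -> fstream h -> fstream w0 ->
  (forall n k i, rcx [::] (fun s => x n s k i) (p n)) ->
  fstream (fun n s => iteri (T n)
    (fun k w => trunc (B n) (h n (spair (spair s (x n s k)) w))) (trunc (B n) (w0 n s))).
Proof.
move=> sB sT sp [q sq hq] [r sr hr] hx.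
exists (fun n => B n * r n + T n * (B n * (q n * ((1 + p n) + 1 + 1))) + 1).
  by auto 20 with scaled.
move=> n i; pose W k s := iteri k (fun k w => trunc (B n) (h n (spair (spair s (x n s k)) w)))
  (trunc (B n) (w0 n s)).
have triv k j : B n <= j -> rcx [::] (fun s => W k s j) 1.
  move=> jB; apply: rcx_eqf (rcx_const _ false) => s.
  by case: k => [|k]; rewrite /W /= /trunc ltnNge jB.
rewrite -[fun s => _]/(fun s => W (T n) s i).
have [iB|/triv hi] := ltnP i (B n); last by apply: rcx_mono (hi _) _; lia.
have := @rcx_serial [::] 'I_(B n) (fun k j s => W k s j)
  (q n * ((1 + p n) + 1 + 1)) (r n) _ _ (T n) (Ordinal iB).
rewrite card_ord => H; apply: rcx_mono (H _ _) _; last by lia.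
  by move=> j; apply: rcx_eqf (hr n j) => s; rewrite /W /= /trunc ltn_ord.
move=> k L' _ hL j.
apply: (@rcx_eqf _ (fun s => h n (spair (spair s (x n s k)) (W k s)) j)).
  by move=> s; rewrite /W /= /trunc ltn_ord.
apply: rcx_subst (hq n j) _; apply: rcx_spair.
  apply: rcx_spair => l; [exact: rcx_var | exact/rcx_nil/hx].
move=> l; have [lB|/triv lB] := ltnP l (B n); last exact: rcx_nil.
by apply: rcx_mono (rcx_in (hL (Ordinal lB))) _.
Qed.

(** Reading [f] from its top bit gives prefixes that lead from 0 to [f], each the half of the next.
    A circuit that turns a realizer at x/2 into one at x is applied along them. *)
Lemma force_pind A S e f : Sigma1bp A -> fenv e -> fnum f ->
  force S e (subst0 Zero A) ->
  force S e (All (Imp (fsubst (fun i => if i is 0 then Half (Var 0) else Var i) A) A)) ->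
  force S (econs f e) A.
Proof.
move=> /Sigma1bp_realizability [R hR] he hf /force_subst0 /= H0 HS.
have [w0 fw0 Hw0] := real_force hR (fenv_cons (fnum_cst 0) he) H0.
have [p sp [bp hp]] := hf.
(* Inputs now have the shape ((s, x), w): the old input, the bits of the induction variable, and a
   realizer of the premise at x/2. *)
pose e' := ecomp (generic p e) (fun _ => sfst).
have he' : fenv e' by apply: fenv_comp fstream_fst; exact: fenv_generic.
have Ee : e' = econs (e' 0) (ecomp e (fun _ s => sfst (sfst s))) by apply: funext; case.
pose S' n s := S n (sfst (sfst s)) /\
  R (scons (e' 0 n s)./2 (env_at e n (sfst (sfst s)))) (ssnd s).
have Hh : force S' e' A.
  have := HS (fun _ s => sfst (sfst s)) S' (e' 0) _ _ (he' 0).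
  case=> [||_ H]; [exact: fstream_comp fstream_fst fstream_fst | by move=> n s [] |].
  rewrite Ee; apply: (H _ S' fstream_id) => //; rewrite force_subst.
  apply: (@force_agree _ _ (econs (fun n s => (e' 0 n s)./2)
      (ecomp e (fun _ s => sfst (sfst s))))) => [[]//|].
  apply: (force_real hR (w := fun _ => ssnd)); last first.
  - by move=> n s [_]; rewrite env_at_cons.
  - exact: fstream_snd.
  - apply: fenv_cons; first exact: fnum_half.
    exact: fenv_comp (fstream_comp fstream_fst fstream_fst).
have [h fh Hh'] := real_force hR he' Hh.
have [B sB HB] := real_zap hR he'.
have E n s x w : x < 2 ^ p n ->
    env_at e' n (spair (spair s (testbit x)) w) = scons x (env_at e n s).
  move=> hx; rewrite -(env_at_generic e s hx).
  by apply: funext => i; rewrite /env_at /e' /ecomp spairK1.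
have HB' n s x w : x < 2 ^ p n -> R (scons x (env_at e n s)) w ->
    R (scons x (env_at e n s)) (trunc (B n) w).
  by move=> hx; rewrite -(E n s x w hx); apply: HB; exact: zap_trunc.
(* Round [k] works at the prefix made of the top k + 1 of the [p n] bits, whose half is the prefix
   of [k] bits. *)
pose x n s k : stream := testbit (f n s %/ 2 ^ (p n - k.+1)).
have hx n k i : rcx [::] (fun s => x n s k i) (p n).
  by apply: rcx_eqf (hp n (p n - k.+1 + i)) => s; rewrite /x /testbit expnD divnMA.
have fW := fstream_iterate sB sp sp fh fw0 hx.
apply: (force_real hR (fenv_cons hf he) fW) => n s hs.
have small k : f n s %/ 2 ^ k < 2 ^ p n by exact: leq_ltn_trans (leq_div _ _) (bp n s).
suff H k : k <= p n -> R (scons (f n s %/ 2 ^ (p n - k)) (env_at e n s))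
    (iteri k (fun k w => trunc (B n) (h n (spair (spair s (x n s k)) w)))
      (trunc (B n) (w0 n s))).
  by have := H (p n) (leqnn _); rewrite subnn divn1 env_at_cons.
elim: k => [_|k IH kp].
  apply: HB' => //; rewrite subn0 divn_small // -[0]/((fun _ _ => 0) n s) -env_at_cons.
  exact: Hw0.
rewrite iteriS; apply: HB' => //; set w := iteri _ _ _ in IH *.
rewrite -(E n s _ w (small _)); apply: Hh'.
have E0 : e' 0 n (spair (spair s (x n s k)) w) = f n s %/ 2 ^ (p n - k.+1).
  by have := congr1 (fun F => F 0) (E n s _ w (small (p n - k.+1))).
split; first by rewrite !spairK1.
rewrite !spairK1 spairK2 E0 -divn2 -divnMA -expnSr -subSn // subSS; apply: IH.
exact: ltnW.
Qed.

Lemma force_IS12 A S e : IS12 A -> fenv e -> force S e A.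
Proof.
case=> {}A HA he.
  apply: force_qfree => // [|n s _]; last exact: sat_BASIC.
  by move: HA => /= H; repeat (case: H => [<-//|H]).
split=> [n s _|g S' hg hS [H0 HS]]; first exact: sat_PIND.
move=> g' S'' f hg' hS' hf; apply: force_pind => //.
- by do 2 apply: fenv_comp => //.
- exact: force_mono H0.
- exact: (force_mono (A := All (Imp _ A)) hg' hS' HS).
Qed.

Theorem IS12_sound A : prv IS12 [::] A -> forall S e, fenv e -> force S e A.
Proof.
move=> H S e he; apply: (prv_force _ _ H) => //.
  by move=> B e'; exact: sat_IS12.
by move=> B S' e'; exact: force_IS12.
Qed.

(** * Circuits simulating machines *)

Lemma circuit_vals_rcons c g x z : circuit_vals (rcons c g) x z =
  rcons (circuit_vals c x z) (gate_val x z (circuit_vals c x z) g).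
Proof. by rewrite /circuit_vals foldl_rcons. Qed.

Lemma size_circuit_vals c x z : size (circuit_vals c x z) = size c.
Proof. by elim/last_ind: c => //= c g IH; rewrite circuit_vals_rcons !size_rcons IH. Qed.

Lemma In_position L (f : bfun) : List.In f L -> exists2 a, a < size L &
  forall s, nth false (rev [seq g s | g : bfun <- L]) a = f s.
Proof.
elim: L => //= g L IH [->|/IH [a ha H]].
  by exists (size L) => // s; rewrite rev_cons nth_rcons size_rev size_map ltnn eqxx.
exists a; first exact: ltnW.
by move=> s; rewrite rev_cons nth_rcons size_rev size_map ha.
Qed.

(** [P] is quantified after [c]: one block of gates works behind every prefix of [p0] gates, in
    particular behind all strings hard-wired by [input_consts]. The gate [var i] delivers bit [i] of
    the input stream. Programs list the last instruction first, hence the reversal. *)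
Lemma slp_circuit L (var : nat -> gate) n k p0 : slp [::] L ->
  (forall i, gate_wf n k p0 (var i)) ->
  exists c, [/\ size c = size L,
    forall p, p < size c -> gate_wf n k (p0 + p) (nth (GConst false) c p) &
    forall P x z s, size P = p0 ->
      (forall i vs, gate_val x z (circuit_vals P x z ++ vs) (var i) = s i) ->
      circuit_vals (P ++ c) x z = circuit_vals P x z ++ rev [seq f s | f : bfun <- L]].
Proof.
move=> + wfv; elim: L => [_|f L IH /= [Hf /IH [c [sc wfc Hc]]]].
  by exists [::]; split=> // P x z s _ _; rewrite !cats0.
suff [g wfg Hg] : exists2 g, gate_wf n k (p0 + size L) g &
    forall P x z s, size P = p0 ->
      (forall i vs, gate_val x z (circuit_vals P x z ++ vs) (var i) = s i) ->
      gate_val x z (circuit_vals P x z ++ rev [seq f s | f : bfun <- L]) g = f s.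
  exists (rcons c g); split; first by rewrite size_rcons sc.
    move=> p; rewrite size_rcons ltnS nth_rcons leq_eqVlt => /orP [/eqP ->|hp].
      by rewrite ltnn eqxx sc.
    by rewrite hp; exact: wfc.
  move=> P x z s hP hv; rewrite -rcons_cat circuit_vals_rcons (Hc P x z s hP hv).
  by rewrite (Hg P x z s hP hv) rev_cons rcons_cat.
have pos h : List.In h L -> exists2 a, a < p0 + size L &
    forall P x z s, size P = p0 ->
      nth false (circuit_vals P x z ++ rev [seq f s | f : bfun <- L]) a = h s.
  move=> /In_position [a ha Ha]; exists (p0 + a); first by rewrite ltn_add2l.
  move=> P x z s hP; rewrite nth_cat size_circuit_vals hP ltnNge leq_addr /= addKn.
  exact: Ha.
rewrite cats0 in Hf.
case: Hf => [/pos [a ha Ha]|[[b ->]|[[i ->]|[[g /pos [a ha Ha] ->]|[[g [h [/pos [a ha Ha] /pos [b hb Hb] ->]]]|[g [h [/pos [a ha Ha] /pos [b hb Hb] ->]]]]]]]].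
(* Circuits have no copy gate; a wire is repeated as a disjunction with itself. *)
- exists (GOr a a); first by rewrite /= ha.
  by move=> P x z s hP _; rewrite /= (Ha P x z s hP) orbb.
- by exists (GConst b).
- exists (var i); last by move=> P x z s _ ->.
  by have := wfv i; case: (var i) => //= [a|a b|a b]; lia.
- by exists (GNot a) => // P x z s hP _; rewrite /= (Ha P x z s hP).
- exists (GAnd a b); first by rewrite /= ha.
  by move=> P x z s hP _; rewrite /= (Ha P x z s hP) (Hb P x z s hP).
- exists (GOr a b); first by rewrite /= ha.
  by move=> P x z s hP _; rewrite /= (Ha P x z s hP) (Hb P x z s hP).
Qed.

Lemma rcx_circuit f p (var : nat -> gate) n k p0 : rcx [::] f p ->
  (forall i, gate_wf n k p0 (var i)) ->
  exists c, [/\ 0 < size c <= p + 1,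
    forall p, p < size c -> gate_wf n k (p0 + p) (nth (GConst false) c p) &
    forall P x z s, size P = p0 ->
      (forall i vs, gate_val x z (circuit_vals P x z ++ vs) (var i) = s i) ->
      circuit_val (P ++ c) x z = f s].
Proof.
move=> [L [hL sL]]; rewrite cats0 => inL wfv.
(* [f] may occur early in the program; repeating it at the end makes it the output, at the price of
   one gate. *)
have hL' : slp [::] (f :: L) by split=> //; rewrite cats0; left.
have [c [sc wfc Hc]] := slp_circuit hL' wfv.
exists c; split=> //; first by rewrite sc /= addn1 ltnS.
move=> P x z s hP hv; rewrite /circuit_val (Hc P x z s hP hv) /= rev_cons.
by rewrite last_cat last_rcons.
Qed.

(* The digits, least significant first, of [CodeSeq.code l]. *)
Definition unary (l : seq nat) : seq bool :=
  flatten [seq rcons (nseq a false) true | a <- l].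

Lemma testbit_code l j : testbit (CodeSeq.code l) j = nth false (unary l) j.
Proof.
elim: l j => [|a l IH] j; first by rewrite /testbit div0n nth_nil.
rewrite /= /unary /= nth_cat -/(unary l) size_rcons size_nseq nth_rcons nth_nseq size_nseq.
have -> : 2 ^ a * (CodeSeq.code l).*2.+1 = (CodeSeq.code l).*2.+1 * 2 ^ a + 0.
  by rewrite addn0 mulnC.
rewrite testbitMD ?expn_gt0 //; case: ltngtP => [ja|ja|->].
- by rewrite ltnS (ltnW ja) /testbit div0n.
- rewrite ltnS leqNgt ja /= -IH.
  have -> : (CodeSeq.code l).*2.+1 = CodeSeq.code l * 2 ^ 1 + 1 by lia.
  by rewrite testbitMD // ltnNge subn_gt0 ja /= -subnDA addn1.
- by rewrite ltnS leqnn subnn /testbit divn1 /= odd_double.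
Qed.

Lemma code_lt l : CodeSeq.code l < 2 ^ size (unary l).
Proof.
elim: l => [//|a l IH]; rewrite /unary /= -/(unary l) size_cat size_rcons size_nseq.
rewrite addSn expnS expnD.
have : 0 < 2 ^ a by rewrite expn_gt0.
set y := 2 ^ size _ in IH *; set c := CodeSeq.code _ in IH *; set p := 2 ^ a => hp.
have : p * (c.*2.+1) <= p * (2 * y).-1 by rewrite leq_mul2l; apply/orP; right; lia.
have : p * (2 * y).-1 < p * (2 * y) by rewrite ltn_mul2l hp; lia.
lia.
Qed.

Lemma unary_cat l l' : unary (l ++ l') = unary l ++ unary l'.
Proof. by rewrite /unary map_cat flatten_cat. Qed.

(** * Clocked runs of machines and their circuits *)

Lemma run_ext M x y y' t : (forall i, i < t -> nth false y i = nth false y' i) ->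
  run M x y t = run M x y' t.
Proof.
elim: t => //= t IH h; rewrite IH => [|i it]; first by rewrite h.
by rewrite h // ltnW.
Qed.

Lemma run_halted M x y t t' : t <= t' -> halted (run M x y t) -> run M x y t' = run M x y t.
Proof.
move=> + h; elim: t' => [|t' IH]; first by rewrite leqn0 => /eqP ->.
by rewrite leq_eqVlt => /orP [/eqP -> //|/IH E]; rewrite /= E /next_config h.
Qed.

Lemma output_run M x y t b : halted (run M x y t) -> output M x y b ->
  cstate (run M x y t) = if b then acc M else rej M.
Proof.
move=> h [t' ht']; rewrite -ht'; case: (leqP t t') => [tt'|/ltnW tt'].
  by rewrite (run_halted tt' h).
rewrite (@run_halted M x y t' t) // /halted ht'.
by case: b {ht'}; rewrite eqxx ?orbT.
Qed.

Definition accepts (M : ntm) (T : nat) (x : seq bool) : bool :=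
  [exists y : T.-tuple bool, cstate (run M x y T) == acc M].

(** Within [T] steps only [T] witness bits are read, so the longer witnesses of [disagree] accept
    the same strings. *)
Lemma acceptsP M T k x : T <= k ->
  reflect (exists y : k.-tuple bool, cstate (run M x y T) = acc M) (accepts M T x).
Proof.
move=> Tk; apply: (iffP existsP) => -[y].
  move=> /eqP <-; exists [tuple nth false y i | i < k]; congr cstate; apply: run_ext => i iT.
  have ik : i < k by exact: leq_trans Tk.
  by have := nth_mktuple (fun i : 'I_k => nth false y i) false (Ordinal ik).
move=> <-; exists [tuple nth false y i | i < T]; apply/eqP; congr cstate; apply: run_ext => i iT.
by have := nth_mktuple (fun i : 'I_T => nth false y i) false (Ordinal iT).
Qed.

Lemma disagree_accepts M T k c x : T <= k -> (forall y, halted (run M x y T)) ->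
  disagree M k c x ->
  (accepts M T x /\ exists z : k.-tuple bool, circuit_val c x z = false) \/
  (~~ accepts M T x /\ forall z : k.-tuple bool, circuit_val c x z = true).
Proof.
move=> Tk h [[y [z [Hy Hz]]]|H]; [left | right]; split.
- by apply/(acceptsP _ _ Tk); exists y; exact: output_run Hy.
- by exists z.
- apply/(acceptsP _ _ Tk) => -[y E].
  have [/(output_run (h y)) E' _] := H y [tuple false | i < k].
  by have := acc_rej M; rewrite -E -E' eqxx.
- by move=> z; have [] := H [tuple false | i < k] z.
Qed.

(** A step is determined by the state, the scanned symbol and the choice bit; circuits handle it by
    running through this finite set of triples. *)
Definition next_state (M : ntm) (r : state M * symbol M * bool) : state M :=
  let: (q, a, b) := r in
  if (q == acc M) || (q == rej M) then q else (step b q a).1.1.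

Definition next_symbol (M : ntm) (r : state M * symbol M * bool) : symbol M :=
  let: (q, a, b) := r in
  if (q == acc M) || (q == rej M) then a else (step b q a).1.2.

Definition next_head (M : ntm) (p : nat) (r : state M * symbol M * bool) : nat :=
  let: (q, a, b) := r in
  if (q == acc M) || (q == rej M) then p
  else if (step b q a).2 is MoveLeft then p.-1 else p.+1.

Lemma next_configE M b (c : config M) :
  let r := (cstate c, ctape c (chead c), b) in
  [/\ cstate (next_config b c) = next_state r,
      chead (next_config b c) = next_head (chead c) r &
      forall i, ctape (next_config b c) i =
        if i == chead c then next_symbol r else ctape c i].
Proof.
rewrite /= /next_config /halted; case: ifP => _; first by split=> // i; case: eqP => [->|].
by case: (step _ _ _) => -[q a] m.
Qed.

Lemma next_head_leq (M : ntm) p (r : state M * symbol M * bool) : next_head p r <= p.+1.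
Proof. by case: r => -[q a] b /=; case: ifP => // _; case: (step _ _ _).2; lia. Qed.

(** One-hot encoding of a configuration: a wire per state, per head position and per pair of cell
    and symbol. In [T] steps the head stays within T + 1 cells. *)
Definition tm_item (M : ntm) (T : nat) : finType :=
  ((state M + 'I_T.+1) + ('I_T.+1 * symbol M))%type.

Definition tm_bit (M : ntm) (T : nat) (c : config M) (i : tm_item M T) : bool :=
  match i with
  | inl (inl q) => cstate c == q
  | inl (inr p) => chead c == p
  | inr (p, a) => ctape c p == a
  end.

(** The tableau of the run, row by row: T steps, O(T) wires in a row, and O(T^2) gates for a wire of
    the next row, namely O(T) head positions with a test of size O(T) on the scanned triple. *)
Lemma rcx_accepting_run M : exists C, forall m T,
  rcx [::] (fun s => cstate (run M (mkseq (sfst s) m) (mkseq (ssnd s) T) T) == acc M)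
    (C * T.+1 ^ 4).
Proof.
set K := #|{: state M * symbol M * bool}|; set Q := #|state M| + 1 + #|symbol M|.
exists (8 * Q + Q * (40 * K.+1)) => m T.
pose conf s t := run M (mkseq (sfst s) m) (mkseq (ssnd s) T) (minn t T).
have head_leq t s : chead (conf s t) <= minn t T.
  rewrite /conf; elim: (minn t T) => //= t' IH.
  have [_ -> _] := next_configE (nth false (mkseq (ssnd s) T) t')
     (run M (mkseq (sfst s) m) (mkseq (ssnd s) T) t').
  by apply: leq_trans (next_head_leq _ _) _.
(* Size of an arbitrary predicate of the scanned triple: [K] equality tests, each running over all
   cells. *)
pose psi := K * (((2 * T.+1 + 2) + 5) + 1) + 1.
have H0 i : rcx [::] (fun s => @tm_bit M T (conf s 0) i) 8.
  rewrite /conf min0n; case: i => [[q|p]|[p a]] /=.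
  - by apply: rcx_mono (rcx_const _ _) _.
  - by apply: rcx_mono (rcx_const _ _) _.
  have [pm|pm] := ltnP p m; last first.
    by apply: rcx_mono (rcx_eqf _ (rcx_const _ (blank M == a))) _ => // s; rewrite size_mkseq ltnNge pm.
  apply: rcx_mono (rcx_eqf _ (rcx_if (rcx_var _ p.*2) (rcx_const _ (insym M true == a))
    (rcx_const _ (insym M false == a)))) _ => // s.
  by rewrite /= size_mkseq pm nth_mkseq // /sfst; case: (s _).
have := @rcx_serial [::] (tm_item M T) (fun t i s => tm_bit (conf s t) i)
  (T.+1 * (psi + 3) + 10) 8 _ _ T (inl (inl (acc M))).
rewrite /= /conf minnn => H; apply: rcx_mono (H H0 _) _; last first.
  have -> : #|tm_item M T| = #|state M| + T.+1 + T.+1 * #|symbol M|.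
    by rewrite !card_sum card_prod card_ord.
  set t := T.+1; have t0 : 0 < t by [].
  have h1 : #|state M| + t + t * #|symbol M| <= t * Q by rewrite /Q; nia.
  have h2 : t * (psi + 3) + 10 <= 40 * K.+1 * t ^ 2.
    by rewrite /psi -/t -mulnn; nia.
  have t1 : t <= t ^ 4 by rewrite -{1}(expn1 t) leq_pexp2l.
  have t2 : t * t * t ^ 2 = t ^ 4 by rewrite mulnn -expnD.
  rewrite [leqRHS]mulnDl; apply: leq_add.
    by apply: (leq_trans (n := t * Q * 8)); nia.
  apply: (leq_trans (n := t * (t * Q * (40 * K.+1 * t ^ 2)))); last by rewrite -t2; nia.
  by rewrite leq_mul // ?leq_mul // /t leqW.
move=> t L' _ hL i.
have [tT|tT] := ltnP t T; last first.
  apply: rcx_mono (rcx_eqf _ (rcx_in (hL i))) _ => // s.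
  by rewrite (minn_idPr tT) (minn_idPr (leqW tT)).
rewrite (minn_idPl tT) in hL *; have := hL; rewrite (minn_idPl (ltnW tT)) {hL} => hL.
pose c s := run M (mkseq (sfst s) m) (mkseq (ssnd s) T) t.
pose rd s := (cstate (c s), ctape (c s) (chead (c s)), s t.*2.+1).
have hT s : chead (c s) < T.+1.
  by have := head_leq t s; rewrite /conf (minn_idPl (ltnW tT)) -/(c s); lia.
have hhead (p : 'I_T.+1) : rcx L' (fun s => chead (c s) == p) 0.
  exact: rcx_in (hL (inl (inr p))).
have htape (p : 'I_T.+1) a : rcx L' (fun s => ctape (c s) p == a) 0.
  exact: rcx_in (hL (inr (p, a))).
have hscan a : rcx L' (fun s => ctape (c s) (chead (c s)) == a) (2 * T.+1 + 2).
  have := rcx_exists (J := 'I_T.+1) predT (fun p => rcx_and (hhead p) (htape p a)).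
  rewrite card_ord => H'; apply: rcx_mono (rcx_eqf _ H') _ => [s|]; last lia.
  apply/existsP/idP => [[p /= /andP [/eqP -> //]]|h].
  by exists (Ordinal (hT s)); rewrite /= eqxx.
have hrd r : rcx L' (fun s => rd s == r) (2 * T.+1 + 2 + 5).
  case: r => -[q a] b.
  have hq : rcx L' (fun s => cstate (c s) == q) 0 by exact: rcx_in (hL (inl (inl q))).
  have hb : rcx L' (fun s => s t.*2.+1 == b) 2.
    case: b; first by apply: rcx_mono (rcx_eqf _ (rcx_var _ t.*2.+1)) _ => // s; rewrite eqb_id.
    by apply: rcx_mono (rcx_eqf _ (rcx_not (rcx_var _ t.*2.+1))) _ => // s; rewrite eqbF_neg.
  by apply: rcx_mono (rcx_and (rcx_and hq (hscan a)) hb) _; lia.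
have hpsi (P : pred (state M * symbol M * bool)) : rcx L' (fun s => P (rd s)) psi.
  have := rcx_exists P hrd; apply: rcx_eqf => s.
  by apply/existsP/idP => [[r /andP [Pr /eqP ->]] //|h]; exists (rd s); rewrite h eqxx.
have hnext s : let c' := run M (mkseq (sfst s) m) (mkseq (ssnd s) T) t.+1 in
    [/\ cstate c' = next_state (rd s), chead c' = next_head (chead (c s)) (rd s) &
      forall i, ctape c' i = if i == chead (c s) then next_symbol (rd s) else ctape (c s) i].
  have E : s t.*2.+1 = nth false (mkseq (ssnd s) T) t by rewrite nth_mkseq.
  by rewrite /rd E; exact: next_configE.
case: i => [[q|p]|[p a]].
- apply: rcx_mono (rcx_eqf _ (hpsi (fun r => next_state r == q))) _ => [s|]; last lia.
  by have [/= -> _ _] := hnext s.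
- have := rcx_exists (J := 'I_T.+1) predT
    (fun p' => rcx_and (hhead p') (hpsi (fun r => next_head p' r == p))).
  rewrite card_ord => H'; apply: rcx_mono (rcx_eqf _ H') _ => [s|]; last lia.
  have [/= _ -> _] := hnext s.
  apply/existsP/idP => [[p' /= /andP [/eqP -> //]]|h].
  by exists (Ordinal (hT s)); rewrite /= eqxx.
- apply: rcx_mono (rcx_eqf _ (rcx_or
    (rcx_and (hhead p) (hpsi (fun r => next_symbol r == a)))
    (rcx_and (rcx_not (hhead p)) (htape p a)))) _ => [s|]; last lia.
  have [/= _ _ ->] := hnext s; rewrite (eq_sym (p : nat)).
  by case: (chead (c s) == p); rewrite ?orbF.
Qed.

(** * The circuits rejecting a fixed string *)

(* Each input bit is followed by its negation, so that the length of the code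
   does not depend on [u]. *)
Definition input_consts (m : nat) (u : stream) : circuit :=
  [seq GConst b | b <- mkseq (fun j => odd j (+) u j./2) m.*2].

Lemma size_input_consts m u : size (input_consts m u) = m.*2.
Proof. by rewrite size_map size_mkseq. Qed.

Lemma circuit_vals_consts bs x z : circuit_vals [seq GConst b | b <- bs] x z = bs.
Proof. by elim/last_ind: bs => //= bs b IH; rewrite map_rcons circuit_vals_rcons IH. Qed.

(** The two constant gates for a bit have six code entries, exactly one of which is 1. This makes
    seven digits, and only the second and the fifth vary with the bit. *)
Fixpoint input_digits (m : nat) : seq bfun :=
  if m is k.+1 then input_digits k ++
    [:: fun=> true; fun s => ~~ s k; fun=> true; fun=> true; fun s => s k; fun=> true; fun=> true]
  else [::].

Lemma unary_input_consts m u :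
  unary (flatten [seq gate_code g | g <- input_consts m u]) = [seq f u | f : bfun <- input_digits m].
Proof.
elim: m => // m IH; rewrite [input_digits _]/= map_cat -IH /input_consts doubleS.
rewrite !mkseqS !map_rcons !flatten_rcons !unary_cat -catA; congr cat.
by rewrite /= odd_double uphalf_double doubleK; case: (u m).
Qed.

Lemma size_input_digits m : size (input_digits m) = 7 * m.
Proof. by elim: m => //= m IH; rewrite size_cat IH /=; lia. Qed.

Lemma rcx_nth (fs : seq bfun) p : (forall f, List.In f fs -> rcx [::] f p.+1) ->
  forall j, rcx [::] (fun s => nth false [seq f s | f : bfun <- fs] j) p.+1.
Proof.
elim: fs => [_ j|f fs IH H [|j] /=].
- by apply: rcx_mono (rcx_eqf _ (rcx_const _ false)) _ => // s; rewrite nth_nil.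
- by apply: H; left.
- by apply: IH => g hg; apply: H; right.
Qed.

Lemma rcx_input_digits m f : List.In f (input_digits m) -> rcx [::] f 2.
Proof.
elim: m => //= m IH /List.in_app_iff [/IH //|].
have c1 : rcx [::] (fun=> true) 2 by apply: rcx_mono (rcx_const _ _) _.
have c2 : rcx [::] (fun s => s m) 2 by apply: rcx_mono (rcx_var _ _) _.
have c3 : rcx [::] (fun s => ~~ s m) 2 by exact: rcx_not (rcx_var _ _).
by repeat (case=> [<- //|]).
Qed.

Lemma size_gate_code n k p g : gate_wf n k p g ->
  size (unary (gate_code g)) <= n + k + 2 * p + 10.
Proof.
case: g => [b|i|j|a|a b|a b] /=;
  rewrite /unary /= ?size_cat ?size_rcons ?size_nseq /= ?size_rcons ?size_nseq ?size_cat
    ?size_rcons ?size_nseq /=; lia.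
Qed.

Lemma size_circuit_code c X :
  (forall p, p < size c -> size (unary (gate_code (nth (GConst false) c p))) <= X) ->
  size (unary (flatten [seq gate_code g | g <- c])) <= size c * X.
Proof.
elim: c => //= g c IH H; rewrite unary_cat size_cat mulSn leq_add //; first exact: (H 0).
by apply: IH => p hp; exact: (H p.+1).
Qed.

Lemma gate_wf_mono n n' k k' p g : n <= n' -> k <= k' -> gate_wf n k p g -> gate_wf n' k' p g.
Proof. by case: g => //= i hn hk h; exact: leq_trans h _. Qed.

(** Only digits among the first 7 * m n vary with the input, each with a single bit; the others
    belong to a fixed circuit and are hard-wired. *)
Lemma fnum_circuit_code m X (c : nat -> circuit) : scaled m -> scaled X ->
  (forall n, size (unary (flatten [seq gate_code g | g <- c n])) <= X n) ->
  fnum (fun n s => CodeSeq.code (flatten [seq gate_code g | g <- input_consts (m n) s ++ c n])).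
Proof.
move=> sm sX hX.
have E n s : unary (flatten [seq gate_code g | g <- input_consts (m n) s ++ c n]) =
    [seq f s | f : bfun <- input_digits (m n) ++
       [seq (fun=> b) | b <- unary (flatten [seq gate_code g | g <- c n])]].
  rewrite !map_cat flatten_cat unary_cat unary_input_consts; congr cat.
  by rewrite -map_comp map_id.
apply: (@fnumI (fun n => 7 * m n + X n) (fun=> 2)); auto with scaled.
  move=> n s; apply: leq_trans (code_lt _) _; rewrite leq_exp2l // E.
  by rewrite size_map size_cat size_map size_input_digits leq_add2l.
move=> n i _; apply: (@rcx_eqf _ (fun s => nth false [seq f s | f : bfun <- input_digits (m n) ++
       [seq (fun=> b) | b <- unary (flatten [seq gate_code g | g <- c n])]] i)).
  by move=> s; rewrite testbit_code E.
apply: rcx_nth => f /List.in_app_iff [/rcx_input_digits //|].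
elim: (unary _) => //= b bs IH [<-|/IH //].
by apply: rcx_mono (rcx_const _ _) _.
Qed.

Lemma rejection_circuit M : exists C, forall m T, exists c : circuit,
  [/\ 0 < size c <= C * T.+1 ^ 4 + 2,
      forall p, p < size c -> gate_wf 0 T (m.*2 + p) (nth (GConst false) c p) &
      forall u x z, circuit_val (input_consts m u ++ c) x z =
        (cstate (run M (mkseq u m) z T) != acc M)].
Proof.
have [C HC] := rcx_accepting_run M; exists C => m T.
(* The run reads bit j of the string at input position 2j, and gate 2j of the constant prefix holds
   exactly that bit. Odd positions are choice bits, taken from z. *)
pose var i := if odd i then (if i./2 < T then GZ i./2 else GConst false)
              else if i./2 < m then GOr i i else GConst false.
have wfv i : gate_wf 0 T m.*2 (var i).
  rewrite /var; case: ifP => oi; case: ifP => //= hi.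
  by rewrite andbb -(odd_double_half i) oi ltn_double.
have [c [sc wfc Hc]] := rcx_circuit (rcx_not (HC m T)) wfv.
exists c; split=> //; first by rewrite -addnA in sc.
move=> u x z.
rewrite (Hc _ x z (spair (fun j => (j < m) && u j) (fun j => (j < T) && nth false z j))).
- rewrite spairK1 spairK2; congr (cstate _ != _).
  have -> : mkseq (fun j => (j < m) && u j) m = mkseq u m.
    by apply/eq_in_map => j; rewrite mem_iota /= => ->.
  by apply: run_ext => i iT; rewrite nth_mkseq // iT.
- exact: size_input_consts.
move=> i vs; rewrite /var /spair; case: ifP => oi; case: ifP => hi; rewrite /= ?hi //.
rewrite orbb nth_cat circuit_vals_consts size_mkseq.
have im : i < m.*2 by rewrite -(odd_double_half i) oi ltn_double.
by rewrite im nth_mkseq // oi.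
Qed.

(** * Polynomial growth against the size bound *)

Definition polyb (b : nat -> nat) : Prop := exists c, forall n, b n <= n.+2 ^ c.

Lemma polyb_const k : polyb (fun=> k).
Proof.
exists k => n; apply: leq_trans (ltnW (ltn_expl k (isT : 1 < 2))) _.
by case: k => // k; rewrite leq_exp2r.
Qed.

Lemma polybM a b : polyb a -> polyb b -> polyb (fun n => a n * b n).
Proof. by move=> [c hc] [d hd]; exists (c + d) => n; rewrite expnD leq_mul. Qed.

Lemma polybD a b : polyb a -> polyb b -> polyb (fun n => a n + b n).
Proof.
move=> [c hc] [d hd]; exists (c + d).+1 => n.
have h1 : n.+2 ^ c <= n.+2 ^ (c + d) by rewrite leq_exp2l // leq_addr.
have h2 : n.+2 ^ d <= n.+2 ^ (c + d) by rewrite leq_exp2l // leq_addl.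
rewrite expnS; have := hc n; have := hd n; nia.
Qed.

Lemma polybX a k : polyb a -> polyb (fun n => a n ^ k).
Proof. by move=> [c hc]; exists (c * k) => n; rewrite expnM; case: k => // k; rewrite leq_exp2r. Qed.

Lemma polyb_id : polyb id.
Proof. by exists 1 => n; rewrite expn1 ltnW. Qed.

Lemma polyb_scaled b : polyb b -> scaled b.
Proof.
move=> [c hc]; exists c => n; apply: leq_trans (hc n) _.
rewrite mulnC expnM; case: c {hc} => // c; rewrite leq_exp2r //; exact: ltn_expl.
Qed.

(** A polynomial in l^q is 2^O(log l); the threshold comes from the cruder estimate l^q + 2 <= 2^((l
    + 1)(q + 1)). *)
Lemma polyb_small b q : polyb b -> 0 < q ->
  exists l0, forall l, l0 <= l -> b (l ^ q) <= 2 ^ (l ^ 2).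
Proof.
move=> [c hc] q0; exists (2 * (q.+1 * c)).+1 => l hl; apply: leq_trans (hc _) _.
have h : (l ^ q).+2 <= 2 ^ (l.+1 * q.+1).
  rewrite expnM; apply: (leq_trans (n := l.+2 ^ q.+1)); last by rewrite leq_exp2r // ltn_expl.
  have h1 : l ^ q <= l.+2 ^ q by rewrite leq_exp2r //; lia.
  have h2 : l.+2 ^ 1 <= l.+2 ^ q by rewrite leq_exp2l.
  by rewrite expnS; rewrite expn1 in h2; nia.
apply: (leq_trans (n := (2 ^ (l.+1 * q.+1)) ^ c)).
  by case: c {hc hl} => // c; rewrite leq_exp2r.
by rewrite -expnM leq_exp2l // -mulnA -mulnn; nia.
Qed.

(** The exponent (l^q)^delta = l^(q delta) is at least l^2; the bound is an integer, so it survives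
    rounding down. *)
Lemma exp_size_ge delta q l : (0 < delta)%R -> (2%:R <= delta * q%:R)%R -> 0 < l ->
  2 ^ (l ^ 2) <= exp_size delta (l ^ q).
Proof.
move=> d0 hq l0; rewrite /exp_size.
set R := Rdefinitions.R.
have l1 : (1 <= l%:R :> R)%R by rewrite ler1n.
have h : ((l ^ 2)%:R <= powR ((l ^ q)%:R : R) (ratr delta))%R.
  rewrite !natrX -!powR_mulrn ?ler0n // -powRrM ler_powR //.
  have : (ratr 2%:R <= ratr (delta * q%:R) :> R)%R by rewrite ler_rat.
  by rewrite rmorphM /= !ratr_nat mulrC.
rewrite truncn_ge_nat ?powR_ge0 // natrX -powR_mulrn ?ler0n //.
by rewrite ler_powR // ler1n.
Qed.

(** * The lower bound *)

Lemma size_bits x : size (bits x) = bitlen x.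
Proof. by rewrite /bits size_rev size_map size_iota. Qed.

(** For n > 0, the least N with ||N|| = n; its length 2^(n-1) makes it feasible as a constant. *)
Definition tower (n : nat) : nat := 2 ^ (2 ^ n.-1).-1.

Lemma bitlen_tower n : 0 < n -> bitlen (bitlen (tower n)) = n.
Proof.
by move=> n0; rewrite /tower bitlen_exp2 prednK ?expn_gt0 // bitlen_exp2 prednK.
Qed.

Lemma teval_numeral e n : teval e (numeral n) = n.
Proof. by elim: n => //= n ->. Qed.

Lemma sat_LB_instance (M : ntm) (s : nat -> nat) (C E : formula) n0 e n D c x :
  is_Circuit_formula s C -> is_Error_formula M s E ->
  e 0 = x -> e 1 = D -> e 2 = n -> e 3 = tower n ->
  0 < n -> n0 <= n -> encodes_circuit s D n c ->
  sat e (Imp (And (Eq (Var 2) (Len (Len (Var 3))))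
                  (And (Le (numeral n0) (Var 2)) (inst [:: Var 1; Var 2] C)))
             (And (Eq (Len (Var 0)) (Var 2)) (inst [:: Var 1; Var 2; Var 0] E))) ->
  bitlen x = n /\ disagree M (s n) c (bits x).
Proof.
move=> [_ _ HC] [_ HE] e0 e1 e2 e3 n_gt0 n0n Hc /=.
rewrite teval_numeral e0 e2 e3 bitlen_tower // !sat_subst => -[].
  split=> //; split=> //; apply/HC; exists c.
  by rewrite /= e1 e2.
move=> xn HEr; split=> //.
have := HE (fun i => teval e (nth Zero [:: Var 1; Var 2; Var 0] i)) c.
rewrite /= e0 e1 e2 => H; exact/H.
Qed.

(** N and n are instantiated by constants, D by a feasible function. The existential quantifier
    stands outside the implication, so forcing hands over its witness at once; from then on only the
    truth of the implication at each input is used. *)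
Lemma LB_witness (M : ntm) s C E n0 (Df : nat -> stream -> nat) :
  is_Circuit_formula s C -> is_Error_formula M s E ->
  prv IS12 [::] (LB_exp C E n0) -> fnum Df ->
  exists2 x, fnum x & forall n u c, 0 < n -> n0 <= n -> encodes_circuit s (Df n u) n c ->
    bitlen (x n u) = n /\ disagree M (s n) c (bits (x n u)).
Proof.
move=> HC HE H hD.
have hN : fnum (fun n _ => tower n).
  apply: (@fnum_const (fun n => 2 ^ n)) => [|n]; first by exists 1 => n; rewrite mul1n leq_exp2l.
  by rewrite ltn_exp2l // prednK ?expn_gt0 // leq_exp2l // leq_pred.
have hn : fnum (fun n _ => n).
  by apply: (@fnum_const id) => [|n]; [exact: polyb_scaled polyb_id | exact: ltn_expl].
have he : fenv (fun _ _ _ => 0) by move=> i; exact: fnum_cst.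
pose S : world := fun _ _ => True.
have ST g n s' : S n s' -> S n (g n s') by [].
have := IS12_sound H S he.
move=> /(_ _ S _ fstream_id (ST _) hN) /(_ _ S _ fstream_id (ST _) hn).
move=> /(_ _ S _ fstream_id (ST _) hD) [x hx [Hx _]].
exists x => // n u c n_gt0 n0n Hc.
by apply: (sat_LB_instance HC HE _ _ _ _ n_gt0 n0n Hc (Hx n u I)).
Qed.

Lemma LB_true (M : ntm) s C E n0 :
  is_Circuit_formula s C -> is_Error_formula M s E ->
  prv IS12 [::] (LB_exp C E n0) -> forall n c, 0 < n -> n0 <= n ->
  circuit_wf n (s n) c -> size c <= s n ->
  exists2 x, bitlen x = n & disagree M (s n) c (bits x).
Proof.
move=> HC HE H n c n_gt0 n0n wfc sc.
have Hc : encodes_circuit s (CodeSeq.code (flatten (map gate_code c))) n c by [].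
have [x Hx] := prv_sat (@sat_IS12) H (e := fun=> 0) (fun _ f => match f with end)
  (tower n) n (CodeSeq.code (flatten (map gate_code c))).
by have [] := sat_LB_instance HC HE erefl erefl erefl erefl n_gt0 n0n Hc Hx; exists x.
Qed.

Theorem theorem3p6 (delta : rat) (delta_gt0 : (0 < delta)%R) (n0 : nat)
    (M : ntm) (M_poly : polytime M) (Circuit Error : formula)
    (HCircuit : is_Circuit_formula (exp_size delta) Circuit)
    (HError : is_Error_formula M (exp_size delta) Error) :
  ~ prv IS12 [::] (LB_exp Circuit Error n0).
Proof.
move=> H; have [k Hk] := M_poly.
have [q q0 hq] : exists2 q : nat, 0 < q & (2%:R <= delta * q%:R)%R.
  have h2 : (0 < 2%:R / delta :> rat)%R by rewrite divr_gt0.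
  exists (Num.bound (2%:R / delta)%R); last first.
    by rewrite mulrC -ler_pdivrMr // ltW // archi_boundP // ltW.
  by rewrite -(ltr_nat rat) (lt_trans h2) // archi_boundP // ltW.
have hs l : 0 < l -> 2 ^ (l ^ 2) <= exp_size delta (l ^ q) by exact: exp_size_ge.
move: (exp_size delta) hs HCircuit HError => s hs HCircuit HError {hq delta_gt0 delta}.
pose m n := n ^ q; pose time n := m n ^ k + k.
have halts x y n : size x = m n -> halted (run M x y (time n)).
  by move=> sx; rewrite /time -sx; exact: Hk.
have pm : polyb m by exact: polybX polyb_id.
have pt : polyb time by apply: polybD _ (polyb_const _); exact: polybX.
have [C HC] := rejection_circuit M.
have [c Hc] := choice (fun n => HC (m n) (time n)).
pose len n := C * (time n).+1 ^ 4 + 2.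
have plen : polyb len.
  apply: polybD _ (polyb_const _); apply: polybM (polyb_const _) _.
  apply: polybX; have [d hd] := polybD pt (polyb_const 1).
  by exists d => n; rewrite -addn1.
pose X n := len n * (time n + 2 * ((m n).*2 + len n) + 10).
have pX : polyb X.
  have pm2 : polyb (fun n => (m n).*2).
    by have [d hd] := polybM (polyb_const 2) pm; exists d => n; rewrite -mul2n.
  apply: (polybM plen); apply: polybD _ (polyb_const _); apply: polybD pt _.
  by apply: polybM (polyb_const 2) _; exact: polybD pm2 plen.
have codeX n : size (unary (flatten [seq gate_code g | g <- c n])) <= X n.
  have [/andP [_ sc] wfc _] := Hc n.
  apply: leq_trans (leq_mul sc (leqnn _)); apply: size_circuit_code => p hp.
  apply: leq_trans (size_gate_code (wfc p hp)) _; rewrite add0n leq_add2r leq_add2l.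
  by rewrite leq_mul2l leq_add2l (leq_trans (ltnW hp)).
have hD := fnum_circuit_code (polyb_scaled pm) (polyb_scaled pX) codeX.
have [x hx Hx] := LB_witness HCircuit HError H hD.
have [px spx [bx rx]] := hx.
(* Size of the table: 2^n candidates, each compared with [x n u] and paired with a constant
   answer. *)
pose G n := 2 ^ n * ((px n + n + 1) * (9 * px n + 9 * 1 + 41) + 1 + 2) + 1.
have sG : scaled (fun n => G n + 1 + time n).
  have s1 : scaled (fun n => 2 ^ n) by exists 1 => n; rewrite mul1n leq_exp2l.
  have s2 := polyb_scaled polyb_id; have s3 := polyb_scaled pt.
  by rewrite /G; auto 20 with scaled.
have [d Hd] := sG.
have [l0 Hl0] : exists l0, forall l, l0 <= l -> (m (l ^ q)).*2 + len (l ^ q) + time (l ^ q) <= 2 ^ (l ^ 2).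
  apply: (@polyb_small (fun n => (m n).*2 + len n + time n)) => //.
  apply: polybD _ pt; apply: polybD _ plen.
  by have [d' hd] := polybM (polyb_const 2) pm; exists d' => n; rewrite -mul2n.
(* Here 2 * d + 1 <= l <= n ensures d * (n + 1) <= n^2. As a power l^q, the length n is one at which
   [hs] applies. *)
pose l := l0 + n0 + 2 * d + 1; pose n := l ^ q.
have l_gt0 : 0 < l by rewrite /l addn1.
have ln : l <= n by rewrite -{1}(expn1 l) leq_pexp2l.
have n_gt0 : 0 < n by exact: leq_trans ln.
have nm : n <= m n by rewrite -{1}(expn1 n) leq_pexp2l.
have n0n : n0 <= n by apply: leq_trans ln; rewrite /l; lia.
have sn : (m n).*2 + len n + time n <= s n.
  apply: leq_trans (Hl0 l _) (hs l l_gt0); rewrite /l; lia.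
have sm : G n + 1 + time n <= s (m n).
  apply: leq_trans (Hd n) (leq_trans _ (hs n n_gt0)).
  by rewrite leq_exp2l // -mulnn; have : l <= n by []; rewrite /l; nia.
(* The two clocks differ because [x n u] has length n while the string has length [m n]. *)
have reduction u : bitlen (x n u) = n /\
    accepts M (n ^ k + k) (bits (x n u)) = accepts M (time n) (mkseq u (m n)).
  have [/andP [c0 sc] wfc valc] := Hc n.
  have [] := Hx n u (input_consts (m n) u ++ c n) n_gt0 n0n.
    split=> //; last by rewrite size_cat size_input_consts; rewrite /len in sn; lia.
    split; first by rewrite size_cat addn_gt0 c0 orbT.
    move=> p; rewrite size_cat size_input_consts nth_cat size_input_consts => hp.
    case: ltnP => hp'.
      by rewrite (nth_map false) ?size_mkseq.
    have := wfc (p - (m n).*2); rewrite subnKC // => /(_ _)/gate_wf_mono; apply=> //; lia.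
  move=> xn /disagree_accepts dis; split=> //.
  have tn : n ^ k + k <= s n.
    apply: leq_trans sn; rewrite /time; apply: leq_trans (leq_addl _ _).
    rewrite leq_add2r; case: (k) => // k'; rewrite leq_exp2r //.
  have hn y : halted (run M (bits (x n u)) y (n ^ k + k)).
    by have := Hk (bits (x n u)) y; rewrite size_bits xn.
  have tn' : time n <= s n by lia.
  case: (dis _ tn hn) => [[-> [z Hz]]|[/negbTE -> Hz]].
    apply/esym/(acceptsP _ _ tn'); exists z.
    by move: Hz; rewrite valc => /negbFE /eqP.
  apply/esym/negbTE/(acceptsP _ _ tn') => -[z Ez].
  by have := Hz z; rewrite valc Ez eqxx.
have bx' u : x n u < 2 ^ n by rewrite -bitlen_leq (reduction u).1.
have cx : rcx [::] (fun u => accepts M (time n) (mkseq u (m n))) (G n).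
  apply: (@rcx_eqf _ (fun u => accepts M (n ^ k + k) (bits (x n u)))).
    by move=> u; exact: (reduction u).2.
  apply: (@rcx_lookup [::] (x n) (fun v _ => accepts M (n ^ k + k) (bits v))) => // [v vn|v].
    apply: rcx_eqn => [u|u||i].
    - by apply: leq_trans (bx n u) _; rewrite leq_exp2l // leq_addr.
    - by apply: leq_trans vn _; rewrite leq_exp2l // leq_addl.
    - exact: rx.
    - exact: rcx_const.
  exact: rcx_const.
(* The resulting circuit has no z-inputs: as a co-nondeterministic circuit it gives the same value
   for all z, and it decides every string of length [m n] correctly. *)
pose var i := if i < m n then GX i else GConst false.
have wfv i : gate_wf (m n) 0 0 (var i) by rewrite /var; case: ifP.
have [c' [/andP [c0 sc] wfc valc]] := rcx_circuit cx wfv.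
have [||||y ym dis] := LB_true HCircuit HError H (n := m n) (c := c').
- exact: leq_trans nm.
- exact: leq_trans nm.
- by split=> // p /wfc; apply: gate_wf_mono.
- lia.
have sy : size (bits y) = m n by rewrite size_bits.
have val z : circuit_val c' (bits y) z = accepts M (time n) (bits y).
  rewrite (valc [::] (bits y) z (nth false (bits y))) //.
    by rewrite -sy mkseq_nth.
  move=> i vs; rewrite /var; case: ltnP => //= hi.
  by rewrite nth_default // sy.
have ht : time n <= s (m n) by lia.
have := disagree_accepts ht (fun z => halts _ z _ sy) dis.
case=> [[a [z]]|[a Hz]]; first by rewrite val a.
by have := Hz [tuple false | _ < _]; rewrite val (negbTE a).
Qed.
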